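(* For every $n\in\mathbb{N}$, there exists at least one monomial unicuspidal Kunz curve $C$ of Clifford index $\mathrm{Cliff}(C)=n$.
   Context: $\mathbb{N}$ denotes the set of nonnegative integers. Curves are integral and projective over an algebraically closed field $k$. Clifford index: for a torsion-free sheaf $\mathscr{F}$ of rank $1$ on $C$, $\deg\mathscr{F}:=\chi(\mathscr{F})-\chi(\mathcal{O}_C)$ and $\mathrm{Cliff}(\mathscr{F}):=\deg(\mathscr{F})-2(h^0(\mathscr{F})-1)$. The Clifford index of $C$ is $$\mathrm{Cliff}(C):=\min\{\mathrm{Cliff}(\mathscr{F})\mid \mathscr{F}\text{ torsion-free of rank }1,\ h^0(\mathscr{F})\ge 2\text{ and }h^1(\mathscr{F})\ge 2\}.$$ Kunz: a point $P\in C$ is Gorenstein if the stalk $\omega_P$ of the dualizing sheaf is a free $\mathcal{O}_P$-module. For $P\in C$ let $\overline{\mathcal{O}}_P$ be the integral closure of $\mathcal{O}_P$, $\mathscr{C}_P$ the conductor of $\overline{\mathcal{O}}_P$ into $\mathcal{O}_P$, $\delta_P:=\dim(\overline{\mathcal{O}}_P/\mathcal{O}_P)$ and $\eta_P:=\delta_P-\dim(\mathcal{O}_P/\mathscr{C}_P)$. $C$ is Kunz if it has exactly one non-Gorenstein point $P$ and $\eta_P=1$. Monomial unicuspidal curve: a rational curve $C$ with normalization $\mathbb{P}^1$ (affine coordinate $t$) having exactly one singular point $P$, which is unibranch and lies under $t=0$, whose local ring is the localization at the origin of $k[t^s:s\in S]$ for a numerical semigroup $S$; $C$ is nonsingular away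 from $P$, in particular at the point under $t=\infty$.
   Formalization: Cliff(C) is taken to be 0 when no sheaf has h^0 ≥ 2 and h^1 ≥ 2 (the minimum is then over an empty set); the case n = 0 rests on this convention, since no monomial unicuspidal Kunz curve attains a minimum equal to 0. For n ≥ 1 Cliff(C) is a genuine minimum. *)

(* Defs.v *)
From HB Require Import structures.
From mathcomp Require Import all_boot all_order all_algebra.
From mathcomp Require Import fraction.
From mathcomp Require Import boolp classical_sets functions cardinality.

Set Implicit Arguments.
Unset Strict Implicit.
Unset Printing Implicit Defensive.

Import Order.TTheory GRing.Theory Num.Theory.
Local Open Scope ring_scope.
Local Open Scope classical_set_scope.

(* An integral projective curve over [k] is determined by its function field,
   its set of closed points and the local rings at these points, viewed as
   subrings of the function field.  This record carries exactly that data; the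
   notions below have their usual meaning when the data come from a curve, as
   they do for [monomial_curve] at the end of the file. *)
Record curve (k : closedFieldType) := Curve {
  fun_field : fieldType;
  const : {rmorphism k -> fun_field};
  point : Type;
  local_ring : point -> set fun_field
}.

Section Curves.
Variables (k : closedFieldType) (C : curve k).
Notation K := (fun_field C).
Notation X := (point C).
Notation O := (@local_ring k C).

(* [dimq U W] is the dimension over [k] of the image of [U] in the quotient by
   [W], i.e. of U / W when W is contained in U; the value is 0 by convention if
   this dimension is infinite.  [V] is K itself or the space of functions from
   the points to K, with [k] acting through [const]. *)
Definition basisq (V : lmodType K) (U W : set V) (d : nat) (e : 'I_d -> V) :=
  (forall i, U (e i)) /\
  forall u, U u -> exists! c : {ffun 'I_d -> k},
    W (u - \sum_(i < d) const C (c i) *: e i).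

Definition dimq (V : lmodType K) (U W : set V) : nat :=
  xget 0%N [set d | exists e : 'I_d -> V, basisq U W e].

(** Torsion-free sheaves of rank 1 *)

(* The O_P-submodule of K generated by g_1, ..., g_m. *)
Definition spanO (P : X) (m : nat) (g : 'I_m -> K) : set K :=
  [set x | exists a : 'I_m -> K,
     (forall i, O P (a i)) /\ x = \sum_(i < m) a i * g i].

(* Up to isomorphism, a torsion-free sheaf of rank 1 is a nonzero coherent
   subsheaf of the constant sheaf K.  It is given by its stalks, which are
   nonzero finitely generated O_P-submodules of K, equal to O_P for almost all
   P; every such family of stalks comes from a sheaf. *)
Definition sheaf := X -> set K.

Definition torsion_free_rank1 (F : sheaf) :=
  (forall P, exists m (g : 'I_m -> K),
     (exists i, g i != 0) /\ F P = spanO P g) /\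
  finite_set [set P | F P <> O P].

Definition structure_sheaf : sheaf := O.

Definition adele : set (X -> K^o) :=
  [set r | finite_set [set P | ~ O P (r P)]].

(* The resolution 0 -> F -> K -> \oplus_P K / F_P -> 0 computes cohomology:
   H^0(F) is the intersection of the stalks, and H^1(F) is the quotient of the
   adeles by [H1zero F] = K + \prod_P F_P. *)
Definition H0 (F : sheaf) : set K^o := [set f | forall P, F P f].

Definition H1zero (F : sheaf) : set (X -> K^o) :=
  [set r | exists f : K, forall P, F P (r P - f)].

Definition h0 (F : sheaf) : nat := dimq (H0 F) [set 0].
Definition h1 (F : sheaf) : nat := dimq adele (H1zero F).

Definition euler_char (F : sheaf) : int := (h0 F)%:Z - (h1 F)%:Z.

Definition deg (F : sheaf) : int :=
  euler_char F - euler_char structure_sheaf.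

(** Clifford index *)

Definition Cliff_sheaf (F : sheaf) : int := deg F - 2 * ((h0 F)%:Z - 1).

Definition contributes (F : sheaf) :=
  [/\ torsion_free_rank1 F, (2 <= h0 F)%N & (2 <= h1 F)%N].

(* The minimum of Cliff(F) over the sheaves F that contribute.  If there is no
   such F then Cliff(C) := 0, as is customary for curves of genus 2; in
   particular a nonzero Cliff(C) is always a minimum that is attained. *)
Definition Cliff : int :=
  xget 0 [set c | (exists F, contributes F /\ Cliff_sheaf F = c) /\
                  forall F, contributes F -> c <= Cliff_sheaf F].

(** Dualizing sheaf and Gorenstein points *)

(* Linear forms on H^1(F), as functions of adeles; their values outside
   [adele] are irrelevant. *)
Definition H1dual (F : sheaf) : set ((X -> K^o) -> k) :=
  [set phi |
    (forall (c : k) r s, adele r -> adele s ->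
       phi (const C c *: r + s) = c * phi r + phi s) /\
    (forall r, adele r -> H1zero F r -> phi r = 0)].

(* A homomorphism between nonzero subsheaves of K is multiplication by an
   element of K. *)
Definition Hom (F W : sheaf) : set K :=
  [set f | forall P x, F P x -> W P (f * x)].

(* [W] with trace form [tr] is a dualizing sheaf: the pairing
   Hom(F, W) x H^1(F) -> H^1(W) -> k identifies Hom(F, W) with the dual of
   H^1(F), for every torsion-free F of rank 1.  As W is itself such a sheaf,
   this universal property determines it up to isomorphism. *)
Definition dualizing (W : sheaf) (tr : (X -> K^o) -> k) :=
  [/\ torsion_free_rank1 W, H1dual W tr &
      forall F phi, torsion_free_rank1 F -> H1dual F phi ->
        exists! f : K, Hom F W f /\ forall r, adele r -> phi r = tr (f *: r)].

Definition free_at (P : X) (M : set K) :=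
  exists m (b : 'I_m -> K), (forall i, M (b i)) /\
    forall x, M x -> exists! a : {ffun 'I_m -> K},
      (forall i, O P (a i)) /\ x = \sum_(i < m) a i * b i.

Definition Gorenstein_at (P : X) :=
  exists W tr, dualizing W tr /\ free_at P (W P).

(** Kunz curves *)

Definition integral_closure (P : X) : set K^o :=
  [set x | exists p : {poly K},
     [/\ p \is monic, forall i, O P p`_i & root p x]].

Definition conductor (P : X) : set K^o :=
  [set x | forall y, integral_closure P y -> O P (x * y)].

Definition delta (P : X) : nat := dimq (integral_closure P) (O P : set K^o).

Definition eta (P : X) : int :=
  (delta P)%:Z - (dimq (O P : set K^o) (conductor P))%:Z.

Definition Kunz :=
  exists P, (forall Q, ~ Gorenstein_at Q <-> Q = P) /\ eta P = 1.

End Curves.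

(** Monomial unicuspidal curves *)

Definition numerical_semigroup (S : set nat) :=
  [/\ S 0%N, forall a b, S a -> S b -> S (a + b)%N & finite_set (~` S)].

Section Monomial.
Variables (k : closedFieldType) (S : set nat).

Definition semigroup_ring : set {poly k} := [set p | forall i, p`_i != 0 -> S i].

(* The points of the curve are those of P^1: [Some a] lies under t = a and
   [None] under t = oo.  The local ring is that of P^1, except at t = 0, where
   it is the localization of k[t^s : s in S] at the origin. *)
Definition monomial_local_ring (P : option k) : set {fraction {poly k}} :=
  match P with
  | Some a => [set f | exists p q : {poly k},
      [/\ a = 0 -> semigroup_ring p /\ semigroup_ring q,
          q.[a] != 0 & f = tofrac p / tofrac q]]
  | None => [set f | exists p q : {poly k},
      [/\ q != 0, (size p <= size q)%N & f = tofrac p / tofrac q]]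
  end.

Definition monomial_curve : curve k :=
  @Curve k {fraction {poly k}} (@tofrac {poly k} \o polyC) (option k)
         monomial_local_ring.

End Monomial.

(* The condition [~ S 1] says that the point under t = 0 is singular. *)
Definition monomial_unicuspidal (k : closedFieldType) (C : curve k) :=
  exists S, [/\ numerical_semigroup S, ~ S 1%N & C = monomial_curve k S].

(* Main.v *)
(** Write g for the arithmetic genus, so that Cliff(F) = g + 1 - h0(F) - h1(F).

    After multiplication by a rational function, a torsion-free sheaf of rank 1
    is trivial away from t = 0, so it is given by its stalk M there.  If V is the
    set of orders of the elements of M, then h0(F) is at most the number of v in
    V with v <= 0, and h1(F) is at most the number of v > 0 not in V.  Hence the
    Clifford index is bounded below by a combinatorial problem about sets V with
    V + S contained in V, and the bound is attained for monomial M.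

    The semigroup is determined by two numbers mu and H: its least element is 0 in
    the residue class 0 modulo mu, about 2 H mu in the class mu - 2 and about H mu
    in all other classes.  It is pseudo-symmetric (2 g - 2 is the largest gap and
    g - 1 is the only gap i for which 2 g - 2 - i is a gap), which is the Kunz
    property eta = 1.  If mu <= 2 H + 1, every contributing sheaf has
    h0 + h1 <= g + 3 - mu.  If H > 1, equality holds for the line bundle with stalk
    t^-mu O at t = 0, so Cliff(C) = mu - 2.  For n = 0 we take mu = 3, H = 1,
    where the bound leaves no contributing sheaf.

    For the non-Gorenstein points Serre duality is needed: the dualizing sheaf is
    trivial away from t = 0, and its trace form is the residue at t = 0 against
    the differential dt / t^2, which has neither zeros nor poles elsewhere. *)

Require Import Defs.
From mathcomp Require Import all_boot all_order all_algebra.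
From mathcomp Require Import fraction.
From mathcomp Require Import boolp classical_sets functions cardinality.
From mathcomp Require Import ring zify.

Set Implicit Arguments.
Unset Strict Implicit.
Unset Printing Implicit Defensive.

Import Order.TTheory GRing.Theory Num.Theory.

(** * A pseudo-symmetric semigroup and its modules *)

(* The element [q * mu + r] with [r < mu] lies in the semigroup iff [sgp_height mu H r <= q]. *)
Definition sgp_height (mu H r : nat) : nat :=
  if r == 0 then 0 else if r == mu - 2 then 2 * H else H.

Definition sgp (mu H : nat) : pred nat :=
  fun i => sgp_height mu H (i %% mu) <= i %/ mu.

Lemma sgpE mu H q r : r < mu -> sgp mu H (q * mu + r) = (sgp_height mu H r <= q).
Proof.
by move=> lt_r; rewrite /sgp modnMDl modn_small // divnMDl ?divn_small ?addn0 //; lia.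
Qed.

Lemma sgpD mu H i j : sgp mu H i -> sgp mu H j -> sgp mu H (i + j).
Proof.
case: (posnP mu) => [->|mu_gt0].
  by rewrite /sgp /sgp_height !modn0 !divn0; do 6?[case: ifP => ?]; lia.
have [lt_i lt_j] : i %% mu < mu /\ j %% mu < mu by rewrite !ltn_pmod.
have := divn_eq j mu; have := divn_eq i mu; rewrite {1 2}/sgp.
move: (i %/ mu) (i %% mu) (j %/ mu) (j %% mu) lt_i lt_j => q r q' r' lt_r lt_r' -> ->.
have [lt_rr|le_rr] := ltnP (r + r') mu.
  have -> : q * mu + r + (q' * mu + r') = (q + q') * mu + (r + r') by lia.
  by rewrite sgpE // /sgp_height; do 6?[case: eqP => ?]; lia.
have -> : q * mu + r + (q' * mu + r') = (q + q').+1 * mu + (r + r' - mu) by lia.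
by rewrite sgpE /sgp_height; [do 6?[case: eqP => ?]; lia | lia].
Qed.

Section PseudoSymmetric.
Variables mu H : nat.
Hypotheses (mu_ge3 : 2 < mu) (H_gt0 : 0 < H).

Lemma sgp_gt i : 2 * H * mu - 2 < i -> sgp mu H i.
Proof.
move=> lt_i; have lt_r : i %% mu < mu by rewrite ltn_pmod; lia.
rewrite /sgp; move: (divn_eq i mu) lt_i lt_r.
move: (i %/ mu) (i %% mu) => q r -> lt_i lt_r.
have : 2 * H - 1 <= q by rewrite leqNgt; apply/negP => ?; have := leq_mul2r mu q.+2 (2 * H); nia.
by rewrite /sgp_height; case: eqP => //; case: eqP => ? ? ?; nia.
Qed.

Lemma sgp_sym i : i <= 2 * H * mu - 2 -> i <> H * mu - 1 ->
  sgp mu H (2 * H * mu - 2 - i) = ~~ sgp mu H i.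
Proof.
move=> le_i ne_i; have lt_r : i %% mu < mu by rewrite ltn_pmod; lia.
rewrite {2}/sgp; move: (divn_eq i mu) le_i ne_i lt_r.
move: (i %/ mu) (i %% mu) => q r -> le_i ne_i lt_r.
have lt_q : q < 2 * H by rewrite ltnNge; apply/negP => ?; have := leq_mul2r mu (2 * H) q; nia.
have [le_r|gt_r] := leqP r (mu - 2).
  have -> : 2 * H * mu - 2 - (q * mu + r) = (2 * H - 1 - q) * mu + (mu - 2 - r) by nia.
  by rewrite sgpE /sgp_height; [do 4?[case: eqP => ?]; lia | lia].
have Er : r = mu - 1 by lia.
have lt_q' : q < 2 * H - 1.
  rewrite ltnNge; apply/negP => ?; have Eq : q = 2 * H - 1 by lia.
  by move: le_i; rewrite Eq Er; nia.
have -> : 2 * H * mu - 2 - (q * mu + r) = (2 * H - 2 - q) * mu + (mu - 1) by nia.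
have neq : q <> H - 1 by move=> Eq; apply: ne_i; rewrite Eq Er; nia.
by rewrite Er sgpE /sgp_height; [do 4?[case: eqP => ?]; lia | lia].
Qed.

Lemma sgp_half : ~~ sgp mu H (H * mu - 1).
Proof.
have -> : H * mu - 1 = (H - 1) * mu + (mu - 1) by nia.
by rewrite sgpE /sgp_height; [do 2?[case: eqP => ?]; lia | lia].
Qed.

End PseudoSymmetric.

Lemma sum_nat_mulr (f : nat -> nat) K mu :
  \sum_(i < K * mu) f i = \sum_(r < mu) \sum_(q < K) f (q * mu + r).
Proof.
rewrite exchange_big /=; elim: K => [|K IHK]; first by rewrite !big_ord0.
rewrite big_ord_recr -IHK /= -(big_mkord xpredT f) -[\sum_(i < K * mu) _](big_mkord xpredT f).
rewrite mulSnr (big_cat_nat (n := K * mu)) ?leq_addr //=; congr (_ + _).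
rewrite -{1}[K * mu]add0n big_addn addKn big_mkord.
by apply: eq_bigr => i _; rewrite addnC.
Qed.

Lemma sum_window n z K :
  \sum_(q < K) ((q < n) && (z <= q)) = minn n K - z.
Proof. by elim: K => [|K IHK]; [rewrite big_ord0; lia | rewrite big_ord_recr /= IHK; lia]. Qed.

Lemma count_iota (a : pred nat) d m N : d + m <= N ->
  count a (iota d m) = \sum_(i < N) ((d <= i < d + m) && a i).
Proof.
move=> le_N; rewrite -sum1_count (_ : iota d m = index_iota d (d + m)); last first.
  by rewrite /index_iota addKn.
rewrite (big_nat_widen _ _ N) // (big_nat_widenl _ 0) // big_mkord big_mkcond /=.
by apply: eq_bigr => i _; case: (a i); case: (d <= i); case: (i < d + m).
Qed.

Lemma sum_two_special mu (f : nat -> nat) p r c : p < mu -> r < mu -> p <> r ->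
  (forall i, i < mu -> i <> p -> i <> r -> f i <= c) ->
  \sum_(i < mu) f i <= f p + f r + (mu - 2) * c.
Proof.
move=> lt_p lt_r /eqP ne_pr le_fc.
rewrite (bigD1 (Ordinal lt_p)) //= (bigD1 (Ordinal lt_r)) /=; last by rewrite -val_eqE /= eq_sym.
rewrite addnA leq_add2l.
apply: (@leq_trans (\sum_(i < mu | (i != Ordinal lt_p) && (i != Ordinal lt_r)) c)).
  apply: leq_sum => i /andP[]; rewrite -!val_eqE /= => ip ir.
  by apply: le_fc; [exact: ltn_ord | exact/eqP | exact/eqP].
rewrite sum_nat_const leq_mul2r; apply/orP; right.
have := cardC (pred2 (Ordinal lt_p) (Ordinal lt_r)).
rewrite card2 card_ord -val_eqE /= ne_pr.
set c1 := #|_|; set c2 := #|_|; have -> : c2 = c1; last by lia.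
by apply: eq_card => i; rewrite !inE negb_or.
Qed.

Lemma sum_ge2_other mu (f : nat -> nat) r0 : r0 < mu -> f r0 <= 1 -> 1 < \sum_(r < mu) f r ->
  exists r, [/\ r < mu, r <> r0 & 0 < f r].
Proof.
move=> lt_r0 f0; rewrite (bigD1 (Ordinal lt_r0)) //= => gt1.
have : \sum_(i < mu | i != Ordinal lt_r0) f i != 0.
  by move: f0 gt1; set s := \sum_(_ < _ | _) _; lia.
rewrite sum_nat_eq0 => /forallPn[i]; rewrite negb_imply -val_eqE /= => /andP[ir0 fi].
by exists i; split; [exact: ltn_ord | exact/eqP | lia].
Qed.

Section Bound.
Variables mu H : nat.
Hypotheses (mu_ge3 : 2 < mu) (H_gt0 : 0 < H) (mu_leH : mu <= 2 * H + 1).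

(* A module V and a bound d are encoded by residue classes modulo mu: [q * mu + r]
   lies in V iff [z r <= q], and is less than d iff [q < n r]. *)
Variable z n : nat -> nat.
Variables Q rho : nat.
Hypothesis lt_rho : rho < mu.
Hypothesis nE : forall r, n r = Q + (r < rho).
Hypotheses (z0 : z 0 = 0) (z_mid : forall r, 0 < r < mu - 2 -> z r <= H)
  (z_last : z (mu - 1) <= H) (z_top : z (mu - 2) <= 2 * H)
  (z_mid_ge : forall r, 0 < r < mu - 2 -> z (mu - 2) <= z r + H)
  (z_last_ge : z (mu - 2) <= z (mu - 1) + H + 1).

Let A := \sum_(r < mu) (n r - z r).
Let B := \sum_(r < mu) (z r - n r).
Let g r := (n r - z r) + (z r - n r).

Let AB : A + B = \sum_(r < mu) g r.
Proof. by rewrite -big_split. Qed.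

Let classP r : r < mu -> [\/ r = 0, r = mu - 2, r = mu - 1 | 0 < r < mu - 2].
Proof.
move=> lt_r; case: (r =P 0); first by constructor 1.
case: (r =P mu - 2); first by constructor 2.
case: (r =P mu - 1); first by constructor 3.
by constructor 4; lia.
Qed.

Lemma class_bound : 1 < A -> 1 < B -> A + B <= H * mu + 3 - mu.
Proof.
move=> A_ge2 B_ge2; rewrite AB.
have mu_gt0 : 0 < mu by lia.
have [i [lt_i _ zi]] : exists r, [/\ r < mu, r <> 0 & 0 < z r - n r].
  by apply: (@sum_ge2_other mu (fun r => z r - n r)) => //; rewrite z0.
have n0 := nE 0; have nt := nE (mu - 2); have nl := nE (mu - 1).
have ni := nE i.
have [le_m|gt_m] := leqP (z (mu - 2)) H.
  have z_le r : r < mu -> z r <= H.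
    by case/classP => [->|->|->|/z_mid] //; rewrite z0.
  have lt_QH : Q < H by have := z_le i lt_i; lia.
  have [Q0|Q_gt0] := posnP Q.
    have [r0 [lt_r0 r0_neq0 fr0]] : exists r, [/\ r < mu, r <> 0 & 0 < n r - z r].
      by apply: (@sum_ge2_other mu (fun r => n r - z r)) => //; lia.
    have nr0 := nE r0.
    have : \sum_(r < mu) g r <= g 0 + g r0 + (mu - 2) * H.
      apply: sum_two_special => //; first exact: nesym.
      by move=> r lt_r _ _; rewrite /g nE; have := z_le r lt_r; lia.
    by rewrite /g z0; nia.
  have [QH|lt_QH1] : Q = H - 1 \/ Q < H - 1 by lia.
    have [r0 [lt_r0 r0_neq ]] : exists r, [/\ r < mu, r <> i & 0 < z r - n r].
      by apply: (@sum_ge2_other mu (fun r => z r - n r)) => //; have := z_le i lt_i; lia.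
    move=> zr0; have nr0 := nE r0; have zi' := z_le i lt_i; have zr0' := z_le r0 lt_r0.
    have : \sum_(r < mu) g r <= g i + g r0 + (mu - 2) * H.
      apply: sum_two_special => //; first exact: nesym.
      by move=> r lt_r _ _; rewrite /g nE; have := z_le r lt_r; lia.
    by rewrite /g; nia.
  apply: (@leq_trans (\sum_(r < mu) (H - 1))).
    apply: leq_sum => r _; rewrite /g; have := nE r; have := z_le r (ltn_ord r); lia.
  by rewrite sum_nat_const card_ord; nia.
have Q_gt0 : 0 < Q.
  rewrite lt0n; apply/eqP => Q0.
  have [r [lt_r r_neq0 fr]] : exists r, [/\ r < mu, r <> 0 & 0 < n r - z r].
    by apply: (@sum_ge2_other mu (fun r => n r - z r)) => //; lia.
  move: fr; rewrite nE Q0.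
  by case/classP: lt_r => [|->|->|/z_mid_ge] //; lia.
have gt_Q : Q < z (mu - 2) - 1.
  have [|] := leqP (z (mu - 2) - n (mu - 2)) 1; last by lia.
  case/(@sum_ge2_other mu (fun r => z r - n r))/(_ B_ge2) => [|r [lt_r ne_r]]; first by lia.
  by rewrite nE; case/classP: lt_r => [->|//|->|/z_mid]; lia.
have gb r : r < mu -> r <> 0 -> r <> mu - 2 -> g r <= H - 1.
  move=> lt_r r0 r2; rewrite /g nE.
  case/classP: lt_r => [//|//|->|mid_r]; first by lia.
  by have := z_mid mid_r; have := z_mid_ge mid_r; lia.
have : \sum_(r < mu) g r <= g 0 + g (mu - 2) + (mu - 2) * (H - 1).
  by apply: sum_two_special => //; lia.
by rewrite /g z0; nia.
Qed.

End Bound.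

Lemma semimodule_bound mu H (V : pred nat) d m :
  2 < mu -> 0 < H -> mu <= 2 * H + 1 ->
  V 0 -> (forall i s, V i -> sgp mu H s -> V (i + s)) ->
  1 < count V (iota 0 d) -> 1 < count (predC V) (iota d m) ->
  count V (iota 0 d) + count (predC V) (iota d m) <= H * mu + 3 - mu.
Proof.
move=> mu_ge3 H_gt0 mu_leH V0 VD A_ge2 B_ge2.
pose z r := find (fun q => V (q * mu + r)) (iota 0 (2 * H)).
have VS r : r < mu -> forall q, sgp_height mu H r <= q -> V (q * mu + r).
  by move=> lt_r q le_q; rewrite -[_ + r]add0n VD ?sgpE.
have z_le r : z r <= 2 * H by rewrite -(size_iota 0 (2 * H)) find_size.
have Vz r : r < mu -> V (z r * mu + r).
  move=> lt_r; have := z_le r; rewrite leq_eqVlt => /orP[/eqP->|lt_z].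
    by apply: VS => //; rewrite /sgp_height; do 2?case: ifP; lia.
  have hasV : has (fun q => V (q * mu + r)) (iota 0 (2 * H)) by rewrite has_find size_iota.
  by have := nth_find 0 hasV; rewrite -/(z r) nth_iota.
have zP r q : r < mu -> V (q * mu + r) = (z r <= q).
  move=> lt_r; apply/idP/idP => [Vq|le_zq].
    rewrite leqNgt; apply/negP => lt_q.
    have := before_find 0 lt_q; rewrite nth_iota ?Vq //.
    exact: leq_trans lt_q (z_le r).
  have -> : q * mu + r = z r * mu + r + ((q - z r) * mu + 0) by nia.
  by apply: VD (Vz r lt_r) _; rewrite sgpE //; lia.
pose n r := d %/ mu + (r < d %% mu).
have lt_rho : d %% mu < mu by rewrite ltn_pmod; lia.
have nP r q : r < mu -> (q * mu + r < d) = (q < n r).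
  rewrite /n {1}(divn_eq d mu); move: (d %/ mu) (d %% mu) lt_rho => Q rho lt_rho lt_r.
  by case: (ltnP r rho); case: (ltngtP q Q) => [?|?|->]; nia.
pose K := d + m + 2 * H + 1.
have eA : count V (iota 0 d) = \sum_(r < mu) (n r - z r).
  rewrite (@count_iota V 0 d (K * mu)); last by rewrite /K; nia.
  rewrite (sum_nat_mulr (fun i => ((i < d) && V i : nat))); apply: eq_bigr => r _.
  under eq_bigr => q _ do rewrite nP // zP //.
  rewrite sum_window (minn_idPl _) // /n /K.
  by have := leq_div d mu; case: (_ < _); lia.
have leB : count (predC V) (iota d m) <= \sum_(r < mu) (z r - n r).
  apply: (@leq_trans (\sum_(i < K * mu) ((d <= i) && ~~ V i))).
    rewrite (@count_iota _ d m (K * mu)); last by rewrite /K; nia.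
    by apply: leq_sum => i _ /=; case: (d <= i); case: (i < d + m); case: (V i).
  rewrite (sum_nat_mulr (fun i => ((d <= i) && ~~ V i : nat))); apply: leq_sum => r _.
  under eq_bigr => q _ do rewrite leqNgt nP // zP // -leqNgt -ltnNge andbC.
  by rewrite sum_window (minn_idPl _) // /K; have := z_le r; lia.
rewrite eA; apply: (@leq_trans (\sum_(r < mu) (n r - z r) + \sum_(r < mu) (z r - n r))).
  by rewrite leq_add2l.
rewrite eA in A_ge2.
apply: (@class_bound mu H mu_ge3 H_gt0 mu_leH z n (d %/ mu) (d %% mu)) => //.
- by apply/eqP; rewrite -leqn0 -zP //; lia.
- by move=> r /andP[r0 lt_r]; rewrite -zP ?VS /sgp_height; do 2?case: eqP; lia.
- by rewrite -zP ?VS /sgp_height; do 2?case: eqP; lia.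
- move=> r /andP[r0 lt_r]; rewrite -zP; last by lia.
  have -> : (z r + H) * mu + (mu - 2) = z r * mu + r + (H * mu + (mu - 2 - r)) by nia.
  by apply: VD (Vz _ _) _; rewrite ?sgpE /sgp_height; do 2?case: eqP; lia.
- rewrite -zP; last by lia.
  have -> : (z (mu - 1) + H + 1) * mu + (mu - 2) = z (mu - 1) * mu + (mu - 1) + (H * mu + (mu - 1)) by nia.
  by apply: VD (Vz _ _) _; rewrite ?sgpE /sgp_height; do 2?case: eqP; lia.
exact: leq_trans B_ge2 leB.
Qed.

Local Open Scope ring_scope.

(** * Dimensions of quotients *)

Section QuotientDimension.
Variables (k : closedFieldType) (C : curve k) (V : lmodType (fun_field C)).
Implicit Types U W : set V.

Definition subspace W := W 0 /\ forall c x y, W x -> W y -> W (const C c *: x + y).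

Lemma subspaceZ W c x : subspace W -> W x -> W (const C c *: x).
Proof. by case=> W0 Wlin Wx; rewrite -[_ *: _]addr0; apply: Wlin. Qed.

Lemma subspaceD W x y : subspace W -> W x -> W y -> W (x + y).
Proof. by case=> _ Wlin Wx Wy; have := Wlin 1 _ _ Wx Wy; rewrite rmorph1 scale1r. Qed.

Lemma subspaceN W x : subspace W -> W x -> W (- x).
Proof. by move=> hW Wx; have := subspaceZ (-1) hW Wx; rewrite rmorphN1 scaleN1r. Qed.

Lemma subspaceB W x y : subspace W -> W x -> W y -> W (x - y).
Proof. by move=> hW Wx Wy; apply: subspaceD => //; apply: subspaceN. Qed.

Lemma subspace_sum W (I : finType) (f : I -> V) :
  subspace W -> (forall i, W (f i)) -> W (\sum_i f i).
Proof.
move=> hW Wf; elim/big_rec: _ => [|i x _ Wx]; first by case: hW.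
exact: subspaceD.
Qed.

Lemma dependent_rows d d' (A : 'M[k]_(d, d')) : (d' < d)%N ->
  exists c : 'I_d -> k, (exists i, c i != 0) /\ forall j, \sum_i c i * A i j = 0.
Proof.
move=> lt_d; have : kermx A != 0.
  by rewrite -mxrank_eq0 mxrank_ker subn_eq0 -ltnNge; apply: leq_ltn_trans (rank_leq_col A) lt_d.
case/rowV0Pn => v /sub_kermxP vA v0; exists (v 0); split.
  have /rV0Pn[i vi] := v0; by exists i.
by move=> j; have /matrixP/(_ 0 j) := vA; rewrite !mxE.
Qed.

Lemma basisq_indep U W d (e : 'I_d -> V) (c : 'I_d -> k) : subspace W -> U 0 ->
  basisq U W e -> W (\sum_i const C (c i) *: e i) -> forall i, c i = 0.
Proof.
move=> hW U0 [_ /(_ 0 U0)[a [Wa uniq_a]]] Wc i.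
have a0 : a = [ffun=> 0].
  apply: uniq_a; rewrite sub0r; apply: subspaceN => //; apply: subspace_sum => // j.
  by rewrite ffunE rmorph0 scale0r; case: hW.
have ac : a = [ffun j => c j].
  apply: uniq_a; rewrite sub0r; apply: subspaceN => //.
  by under eq_bigr => j _ do rewrite ffunE.
by have := congr1 (fun h : {ffun 'I_d -> k} => h i) (etrans (esym ac) a0); rewrite !ffunE.
Qed.

Lemma basisq_span_le U W d (e : 'I_d -> V) d' (f : 'I_d' -> V) : subspace W -> U 0 ->
  basisq U W e ->
  (forall u, U u -> exists c : 'I_d' -> k, W (u - \sum_i const C (c i) *: f i)) ->
  (d <= d')%N.
Proof.
move=> hW U0 be span; rewrite leqNgt; apply/negP => lt_d.
have [Ue _] := be; have /choice[A WA] := fun i => span _ (Ue i).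
have [c [[i ci0] cA]] := dependent_rows (\matrix_(i, j) A i j) lt_d.
move/eqP: ci0; apply; move: i; apply: (basisq_indep hW U0 be).
have -> : \sum_i const C (c i) *: e i =
    \sum_i const C (c i) *: (e i - \sum_j const C (A i j) *: f j).
  apply/esym; under eq_bigr => i _ do rewrite scalerBr.
  rewrite sumrB -[RHS]subr0; congr (_ - _).
  under eq_bigr => i _ do rewrite scaler_sumr.
  rewrite exchange_big big1 //= => j _.
  under eq_bigr => i _ do rewrite scalerA -rmorphM.
  rewrite -scaler_suml -rmorph_sum.
  by have := cA j; under eq_bigr => i _ do rewrite mxE; move=> ->; rewrite rmorph0 scale0r.
by apply: subspace_sum => // i; apply: subspaceZ.
Qed.

Lemma basisq_sep_le U W d (e : 'I_d -> V) d' (l : 'I_d' -> V -> k) : subspace W -> subspace U ->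
  basisq U W e ->
  (forall j c x y, U x -> U y -> l j (const C c *: x + y) = c * l j x + l j y) ->
  (forall u, U u -> (forall j, l j u = 0) -> W u) ->
  (d <= d')%N.
Proof.
move=> hW hU be lin sep; rewrite leqNgt; apply/negP => lt_d.
have [Ue _] := be; have U0 : U 0 by case: hU.
have [c [[i ci0] cA]] := dependent_rows (\matrix_(i, j) l j (e i)) lt_d.
move/eqP: ci0; apply; move: i; apply: (basisq_indep hW U0 be).
apply: sep => [|j]; first by apply: subspace_sum => // i; apply: subspaceZ.
have := cA j; under eq_bigr => i _ do rewrite mxE.
move=> <-; have l0 : l j 0 = 0.
  by have := lin j (-1) 0 0 U0 U0; rewrite scaler0 addr0 mulN1r addNr.
suff [] : U (\sum_i const C (c i) *: e i) /\
  l j (\sum_i const C (c i) *: e i) = \sum_i c i * l j (e i) by [].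
elim/big_rec2: _ => [//|i x y _ [Uy ly]].
split; first by apply: subspaceD => //; apply: subspaceZ.
by rewrite lin // ly.
Qed.

Lemma dimq_eq U W d (e : 'I_d -> V) (l : 'I_d -> V -> k) : subspace W -> U 0 ->
  (forall i, U (e i)) ->
  (forall u, U u -> W (u - \sum_i const C (l i u) *: e i)) ->
  (forall u (c : 'I_d -> k), U u -> W (u - \sum_i const C (c i) *: e i) ->
    forall i, c i = l i u) ->
  dimq U W = d.
Proof.
move=> hW U0 Ue exl uniql.
have be : basisq U W e.
  split=> // u Uu; exists [ffun i => l i u]; split.
    by under eq_bigr => i _ do rewrite ffunE; apply: exl.
  by move=> c Wc; apply/ffunP => i; rewrite ffunE (uniql u c).
apply: xget_unique => [|d' [e' be']]; first by exists e.
apply/eqP; rewrite eqn_leq; apply/andP; split.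
  by apply: (basisq_span_le (f := e) hW U0 be') => u Uu; exists (fun i => l i u); apply: exl.
apply: (basisq_span_le (f := e') hW U0 be) => u Uu; have [_ /(_ u Uu)[c [Wc _]]] := be'.
by exists c.
Qed.

Lemma dimq_span_le U W d (f : 'I_d -> V) : subspace W -> U 0 ->
  (forall u, U u -> exists c : 'I_d -> k, W (u - \sum_i const C (c i) *: f i)) ->
  (dimq U W <= d)%N.
Proof.
by move=> hW U0 span; rewrite /dimq; case: xgetP => [m _ [e be]|_] //; exact: (basisq_span_le hW U0 be span).
Qed.

Lemma dimq_sep_le U W d (l : 'I_d -> V -> k) : subspace W -> subspace U ->
  (forall j c x y, U x -> U y -> l j (const C c *: x + y) = c * l j x + l j y) ->
  (forall u, U u -> (forall j, l j u = 0) -> W u) ->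
  (dimq U W <= d)%N.
Proof.
by move=> hW hU lin sep; rewrite /dimq; case: xgetP => [m _ [e be]|_] //; exact: (basisq_sep_le hW hU be lin).
Qed.

End QuotientDimension.

Lemma fracP (D : idomainType) (x : {fraction D}) :
  exists p q : D, q != 0 /\ x = tofrac p / tofrac q.
Proof.
elim/quotW: x => r; exists (frac r).1, (frac r).2; split; first exact: denom_ratioP.
have d0 : tofrac (frac r).2 != 0 by rewrite tofrac_eq0 denom_ratioP.
apply: (mulIf d0); rewrite divfK //; unlock FracField.tofrac.
rewrite -[LHS]FracField.pi_mul; apply/eqmodP => /=.
rewrite FracField.equivfE /FracField.mulf !numden_Ratio ?mulf_neq0 ?oner_neq0 ?denom_ratioP //.
by rewrite !mulr1 mulrC.
Qed.

(** * Local rings of the monomial curve *)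

Section LocalRings.
(* The function field is kept abstract, because conversion in the concrete
   {fraction {poly k}} is intractable. *)
Variables (k : closedFieldType) (K : fieldType) (emb : {rmorphism {poly k} -> K}).
Hypothesis emb_inj : injective emb.
Hypothesis emb_frac : forall x : K, exists p q : {poly k}, q != 0 /\ x = emb p / emb q.
Notation t := (emb 'X).
Notation "c %:K" := (emb (polyC c)) (at level 2, format "c %:K").
Implicit Types (S : set nat) (P Q : option k) (x y : K) (p q : {poly k}) (c : k).

Definition local_ring_of S P : set K :=
  match P with
  | Some a => [set f | exists p q : {poly k},
      [/\ a = 0 -> semigroup_ring S p /\ semigroup_ring S q,
          q.[a] != 0 & f = emb p / emb q]]
  | None => [set f | exists p q : {poly k},
      [/\ q != 0, (size p <= size q)%N & f = emb p / emb q]]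
  end.

Lemma emb_eq0 p : (emb p == 0) = (p == 0).
Proof. by rewrite -(rmorph0 emb) (inj_eq emb_inj). Qed.

Lemma embCV c : (c^-1)%:K = c%:K^-1.
Proof. exact: (fmorphV (emb \o polyC) c). Qed.

Lemma tX_neq0 : t != 0.
Proof. by rewrite emb_eq0 polyX_eq0. Qed.
Hint Resolve tX_neq0 : core.

Lemma tXn_neq0 i : t ^+ i != 0.
Proof. exact: expf_neq0. Qed.
Hint Resolve tXn_neq0 : core.

Definition semigroup_set S := S 0%N /\ forall i j, S i -> S j -> S (i + j)%N.

Lemma semigroup_ringC S c : S 0%N -> semigroup_ring S c%:P.
Proof. by move=> S0 i; rewrite coefC; case: i => // i; rewrite eqxx. Qed.

Lemma semigroup_ringB S p q :
  semigroup_ring S p -> semigroup_ring S q -> semigroup_ring S (p - q).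
Proof.
move=> Sp Sq i; rewrite coefB => neq0; have [p0|/Sp //] := eqVneq p`_i 0.
by apply: Sq; apply: contra_neq neq0 => ->; rewrite p0 subr0.
Qed.

Lemma semigroup_ringM S p q : semigroup_set S ->
  semigroup_ring S p -> semigroup_ring S q -> semigroup_ring S (p * q).
Proof.
move=> [_ SD] Sp Sq i neq0; apply: contrapT => nSi; move: neq0; rewrite coefM big1 ?eqxx // => j _.
have [->|/Sp Sj] := eqVneq p`_j 0; first by rewrite mul0r.
have [->|/Sq Sij] := eqVneq q`_(i - j) 0; first by rewrite mulr0.
by case: nSi; rewrite -(subnKC (ltn_ord j : j <= i)%N); apply: SD.
Qed.

Lemma local_ringC S P c : S 0%N -> local_ring_of S P c%:K.
Proof.
move=> S0; case: P => [a|]; exists c%:P, 1; rewrite rmorph1 divr1.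
  by split; [split; exact: semigroup_ringC | rewrite hornerC oner_neq0 |].
by split; [exact: oner_neq0 | rewrite size_polyC size_poly1; case: eqP |].
Qed.

Lemma local_ringB S P x y : semigroup_set S ->
  local_ring_of S P x -> local_ring_of S P y -> local_ring_of S P (x - y).
Proof.
move=> hS; case: P => [a|] [p [q [pq q0 ->]]] [p' [q' [pq' q'0 ->]]].
  exists (p * q' - p' * q), (q * q'); split.
  - move=> a0; case: (pq a0) (pq' a0) => [Sp Sq] [Sp' Sq'].
    by split; [apply: semigroup_ringB; apply: semigroup_ringM | apply: semigroup_ringM].
  - by rewrite hornerM mulf_neq0.
  have q1 : q != 0 by apply: contra_neq q0 => ->; rewrite horner0.
  have q1' : q' != 0 by apply: contra_neq q'0 => ->; rewrite horner0.
  by rewrite -mulNr addf_div ?emb_eq0 // !(rmorphB, rmorphM) mulNr.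
exists (p * q' - p' * q), (q * q'); split; first by rewrite mulf_neq0.
  rewrite size_mul //; apply: leq_trans (size_polyD _ _) _; rewrite size_polyN geq_max.
  apply/andP; split; apply: leq_trans (size_polyMleq _ _) _; rewrite -!subn1 leq_sub2r //.
    exact: leq_add.
  by rewrite addnC; exact: leq_add.
by rewrite -mulNr addf_div ?emb_eq0 // !(rmorphB, rmorphM) mulNr.
Qed.

Lemma local_ringM S P x y : semigroup_set S ->
  local_ring_of S P x -> local_ring_of S P y -> local_ring_of S P (x * y).
Proof.
move=> hS; case: P => [a|] [p [q [pq q0 ->]]] [p' [q' [pq' q'0 ->]]].
  exists (p * p'), (q * q'); split; last by rewrite !rmorphM mulf_div.
  - move=> a0; case: (pq a0) (pq' a0) => [Sp Sq] [Sp' Sq'].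
    by split; apply: semigroup_ringM.
  - by rewrite hornerM mulf_neq0.
exists (p * p'), (q * q'); split; [by rewrite mulf_neq0 | | by rewrite !rmorphM mulf_div].
rewrite [X in (_ <= X)%N]size_mul //; apply: leq_trans (size_polyMleq p p') _.
by rewrite -!subn1 leq_sub2r // leq_add.
Qed.

(* [R P] is the local ring of the projective line at P. *)
Notation R := (local_ring_of [set: nat]).

Lemma semigroup_setT : semigroup_set setT.
Proof. by []. Qed.
Hint Resolve semigroup_setT : core.

Lemma regularP a x : R (Some a) x <-> exists p q, q.[a] != 0 /\ x = emb p / emb q.
Proof. by split=> [[p [q [_ ? ->]]]|[p [q [? ->]]]]; exists p, q. Qed.

Lemma local_ring_regular S a x : a != 0 -> local_ring_of S (Some a) x <-> R (Some a) x.
Proof.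
move=> /eqP a0; rewrite regularP.
by split=> [[p [q [_ ? ->]]]|[p [q [? ->]]]]; exists p, q.
Qed.

Lemma local_ring_sub S P x : local_ring_of S P x -> R P x.
Proof. by case: P => [a|] [p [q [? ? ->]]]; exists p, q. Qed.

Lemma local_ring0 S P : S 0%N -> local_ring_of S P 0.
Proof. by rewrite -(rmorph0 emb) -polyC0; apply: local_ringC. Qed.

Lemma local_ring1 S P : S 0%N -> local_ring_of S P 1.
Proof. by rewrite -(rmorph1 emb) -polyC1; apply: local_ringC. Qed.

Lemma local_ringN S P x : semigroup_set S ->
  local_ring_of S P x -> local_ring_of S P (- x).
Proof. by move=> hS Sx; rewrite -sub0r; apply: local_ringB => //; apply: local_ring0; case: hS. Qed.

Lemma local_ringD S P x y : semigroup_set S ->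
  local_ring_of S P x -> local_ring_of S P y -> local_ring_of S P (x + y).
Proof. by move=> hS Sx Sy; rewrite -[y]opprK; apply: local_ringB => //; apply: local_ringN. Qed.

Lemma local_ringX S P x n : semigroup_set S ->
  local_ring_of S P x -> local_ring_of S P (x ^+ n).
Proof.
move=> hS Sx; elim: n => [|n IHn]; first by rewrite expr0; apply: local_ring1; case: hS.
by rewrite exprS; apply: local_ringM.
Qed.

Lemma local_ring_sum S P (I : eqType) (r : seq I) (f : I -> K) : semigroup_set S ->
  (forall i, i \in r -> local_ring_of S P (f i)) -> local_ring_of S P (\sum_(i <- r) f i).
Proof.
move=> hS Sf; rewrite big_seq; elim/big_rec: _ => [|i x ri Sx]; first by apply: local_ring0; case: hS.
by apply: local_ringD => //; apply: Sf.
Qed.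

Lemma regular_poly a p : R (Some a) (emb p).
Proof. by apply/regularP; exists p, 1; rewrite hornerC oner_neq0 rmorph1 divr1. Qed.

Definition unit_at P x := [/\ x != 0, R P x & R P x^-1].

Lemma unit_atV P x : unit_at P x -> unit_at P x^-1.
Proof. by case=> x0 Rx RVx; split; rewrite ?invr_eq0 ?invrK. Qed.

Lemma unit_atM P x y : unit_at P x -> unit_at P y -> unit_at P (x * y).
Proof.
case=> x0 Rx RVx [y0 Ry RVy]; split; [by rewrite mulf_neq0 | exact: local_ringM |].
by rewrite invfM; apply: local_ringM.
Qed.

Lemma unit_at1 P : unit_at P 1.
Proof. by split; rewrite ?oner_neq0 ?invr1 //; apply: local_ring1. Qed.

Lemma unit_atXz P x (e : int) : unit_at P x -> unit_at P (x ^ e).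
Proof.
have nat n y : unit_at P y -> unit_at P (y ^+ n).
  by move=> Uy; elim: n => [|n IHn]; [exact: unit_at1 | rewrite exprS; exact: unit_atM].
by case: e => n Ux; [exact: nat | rewrite NegzE -exprnN -exprVn; apply: nat; apply: unit_atV].
Qed.

Lemma unit_at_poly a p : p.[a] != 0 -> unit_at (Some a) (emb p).
Proof.
move=> pa0; split; [|exact: regular_poly|].
  by rewrite emb_eq0; apply: contra_neq pa0 => ->; rewrite horner0.
by apply/regularP; exists 1, p; rewrite rmorph1 div1r.
Qed.

Lemma unit_at_infty p q : size p = size q -> p != 0 -> unit_at None (emb p / emb q).
Proof.
move=> eq_sz p0; have q0 : q != 0 by rewrite -size_poly_gt0 -eq_sz size_poly_gt0.
split; first by rewrite mulf_neq0 ?invr_eq0 ?emb_eq0.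
  by exists p, q; rewrite eq_sz.
by exists q, p; rewrite eq_sz invf_div.
Qed.

Definition local_param P : K := if P is Some a then emb ('X - a%:P) else t^-1.

Lemma local_param_neq0 P : local_param P != 0.
Proof. by case: P => [a|] /=; rewrite ?invr_eq0 ?emb_eq0 ?polyX_eq0 ?polyXsubC_eq0. Qed.

Lemma factor_at P x : x != 0 -> exists (e : int) u, unit_at P u /\ x = local_param P ^ e * u.
Proof.
have [p [q [q0 ->]]] := emb_frac x; rewrite mulf_eq0 negb_or emb_eq0 => /andP[p0 _].
case: P => [a|] /=; last first.
  exists ((size q)%:Z - (size p)%:Z), (emb (p * 'X^(size q)) / emb (q * 'X^(size p))).
  split; first by apply: unit_at_infty; rewrite ?mulf_neq0 ?polyX_eq0 ?expf_neq0 ?polyX_eq0 //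
     !size_mulXn // addnC.
  rewrite !rmorphM !rmorphXn /= exprz_inv opprB expfzDr // -exprnN -exprnP.
  move: (tXn_neq0 (size p)) (tXn_neq0 (size q)) => tp0 tq0.
  by field; rewrite tp0 tq0 emb_eq0 q0.
have factor (r : {poly k}) : r != 0 -> exists m s, s.[a] != 0 /\ r = ('X - a%:P) ^+ m * s.
  move=> r0; have [m [s]] := multiplicity_XsubC r a; rewrite r0 /= /root => sa ->.
  by exists m, s; rewrite mulrC.
have [m [p' [p'a ->]]] := factor p p0; have [n [q' [q'a ->]]] := factor q q0.
exists (m%:Z - n%:Z), (emb p' / emb q'); split.
  by apply: unit_atM; [|apply: unit_atV]; apply: unit_at_poly.
rewrite !rmorphM !rmorphXn -mulf_div /=; congr (_ * _).
by rewrite expfzDr ?emb_eq0 ?polyXsubC_eq0 // -exprnN.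
Qed.

Lemma local_param_regular P : R P (local_param P).
Proof.
case: P => [a|]; first exact: regular_poly.
by exists 1, 'X; rewrite polyX_eq0 size_polyX size_poly1 rmorph1 div1r.
Qed.

Lemma regular_or_inv P x : R P x \/ x != 0 /\ exists y, R P y /\ x^-1 = local_param P * y.
Proof.
have [->|x0] := eqVneq x 0; first by left; apply: local_ring0.
have [e [u [[u0 Ru RVu] Ex]]] := factor_at P x0.
have Rpi n : R P (local_param P ^+ n) by apply: local_ringX => //; apply: local_param_regular.
case: e Ex => n Ex; first by left; rewrite Ex; exact: (local_ringM _ (Rpi n) Ru).
right; split=> //; exists (local_param P ^+ n * u^-1); split; first exact: local_ringM.
by rewrite Ex invfM NegzE -exprnN invrK exprS mulrA.
Qed.

Notation z := (Some (0 : k)).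

Lemma local_param0 : local_param z = t.
Proof. by rewrite /= polyC0 subr0. Qed.

Lemma horner_split p q a : q.[a] != 0 -> exists c r, p = c *: q + ('X - a%:P) * r.
Proof.
move=> qa; have : root (p - (p.[a] / q.[a]) *: q) a.
  by rewrite rootE !hornerE divfK ?subrr.
case/factor_theorem => r Er; exists (p.[a] / q.[a]), r.
by rewrite [X in _ + X]mulrC -Er addrC subrK.
Qed.

Lemma regular_split a x : R (Some a) x ->
  exists c y, R (Some a) y /\ x = c%:K + local_param (Some a) * y.
Proof.
case/regularP => p [q [qa ->]]; have [c [r ->]] := horner_split p qa.
exists c, (emb r / emb q); split; first by apply/regularP; exists r, q.
have q0 : emb q != 0.
  by rewrite emb_eq0; apply: contra_neq qa => ->; rewrite horner0.
by rewrite -mul_polyC /= rmorphD !rmorphM /=; field.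
Qed.

Lemma poly_of_regular x : (forall a, R (Some a) x) -> exists p, x = emb p.
Proof.
move=> Rx; have [p [q [q0 Ex]]] := emb_frac x.
elim: {q}(size q) {-2}q p (leqnn (size q)) q0 Ex => [|n IHn] q p.
  by rewrite leqn0 size_poly_eq0 => ->.
move=> le_n q0 Ex; have [/eqP/size_poly1P [c c0 Eq]|nconst] := eqVneq (size q) 1%N.
  by exists (p * (c^-1)%:P); rewrite Ex Eq rmorphM /= embCV.
have /closed_rootP[a qa] := nconst.
have /regularP[p' [q' [qa' Ex']]] := Rx a.
have q'0 : q' != 0 by apply: contra_neq qa' => ->; rewrite horner0.
have Epq : p * q' = p' * q.
  by apply: emb_inj; rewrite !rmorphM; apply/eqP; rewrite -eqr_div ?emb_eq0 // -Ex -Ex'.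
have pa : root p a.
  have := congr1 (horner^~ a) Epq; rewrite !hornerM (rootP qa) mulr0 => /eqP.
  by rewrite mulf_eq0 (negPf qa') orbF.
have /factor_theorem [p1 Ep] := pa; have /factor_theorem [q1 Eq] := qa.
have q10 : q1 != 0 by apply: contra_neq q0 => q10; rewrite Eq q10 mul0r.
apply: (IHn q1 p1) => //.
  by move: le_n; rewrite Eq size_Mmonic ?monicXsubC // size_XsubC addn2.
by rewrite Ex Ep Eq !rmorphM -mulf_div divff ?mulr1 ?emb_eq0 ?polyXsubC_eq0.
Qed.

Lemma regular_infty_size p m : R None (emb p / t ^+ m) -> (size p <= m.+1)%N.
Proof.
case=> p' [q' [q'0 le_sz]]; rewrite -rmorphXn => /eqP.
rewrite eqr_div ?emb_eq0 ?expf_neq0 ?polyX_eq0 // -!rmorphM => /eqP/emb_inj Epq.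
have [->|p0] := eqVneq p 0; first by rewrite size_poly0.
have p'0 : p' != 0.
  apply: contra_neq p0 => p'0; move/eqP: Epq; rewrite p'0 mul0r mulf_eq0 (negPf q'0) orbF.
  by move/eqP.
have := congr1 (fun r : {poly k} => size r) Epq.
rewrite size_mulXn // size_mul // => Esz.
have : ((size p + size q').-1 <= m + size q')%N by rewrite Esz leq_add2l.
move: q'0; rewrite -size_poly_gt0; case: (size q') => // n _.
by rewrite addnS /= addnS -addSn leq_add2r.
Qed.

(* By [polarP] these are the elements of k[1/t]. *)
Definition polar n := forall Q, Q <> z -> R Q n.

Lemma polarC c : polar c%:K.
Proof. by move=> Q _; apply: local_ringC. Qed.

Lemma polarD x y : polar x -> polar y -> polar (x + y).
Proof. by move=> Px Py Q Qz; apply: local_ringD => //; [apply: Px | apply: Py]. Qed.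

Lemma polarM x y : polar x -> polar y -> polar (x * y).
Proof. by move=> Px Py Q Qz; apply: local_ringM => //; [apply: Px | apply: Py]. Qed.

Lemma regular_subV a Q : Q <> Some a -> R Q (emb ('X - a%:P))^-1.
Proof.
case: Q => [b|] ne_ba.
  have : ('X - a%:P).[b] != 0 by rewrite hornerXsubC subr_eq0; apply/eqP => Eb; rewrite Eb in ne_ba.
  by case/unit_at_poly.
exists 1, ('X - a%:P); rewrite polyXsubC_eq0 size_XsubC size_poly1 rmorph1 div1r.
by split.
Qed.

Lemma polarVt i : polar (t ^- i).
Proof.
move=> Q Qz; rewrite -exprVn; apply: local_ringX => //.
by have := regular_subV Qz; rewrite polyC0 subr0.
Qed.

Lemma principal_part P x : exists y, R P (x - y) /\ forall Q, Q <> P -> R Q y.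
Proof.
case: P => [a|]; last first.
  have [p [q [q0 ->]]] := emb_frac x; exists (emb (p %/ q)); split.
    exists (p %% q), q; split=> //; first exact/ltnW/ltn_modpN0.
    rewrite {1}(divp_eq p q) rmorphD rmorphM /= mulrDl mulfK ?emb_eq0 //.
    by rewrite addrC addKr.
  by case=> // a _; apply: regular_poly.
have [->|x0] := eqVneq x 0.
  by exists 0; rewrite subrr; split=> [|Q _]; apply: local_ring0.
have [e [u [[_ Ru _] ->]]] := factor_at (Some a) x0.
have pi0 := local_param_neq0 (Some a).
case: e => n.
  exists 0; rewrite subr0; split=> [|Q _]; last exact: local_ring0.
  by apply: local_ringM => //; apply: local_ringX => //; apply: local_param_regular.
rewrite NegzE -exprnN; elim: {n}n.+1 u Ru => [|n IHn] u Ru.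
  by exists 0; rewrite subr0 expr0 invr1 mul1r; split=> // Q _; apply: local_ring0.
have [c [v [Rv ->]]] := regular_split Ru; have [y [Ry Py]] := IHn v Rv.
exists (local_param (Some a) ^- n.+1 * c%:K + y); split.
  suff -> : local_param (Some a) ^- n.+1 * (c%:K + local_param (Some a) * v)
     - (local_param (Some a) ^- n.+1 * c%:K + y) = local_param (Some a) ^- n * v - y by [].
  move: (local_param (Some a)) pi0 => w w0; have wn0 := expf_neq0 n w0.
  by rewrite exprS; field; rewrite ?w0 ?wn0.
by move=> Q Qa; apply: local_ringD (Py Q Qa) => //; apply: local_ringM (local_ringC _ _ _) => //;
  rewrite -exprVn; apply: local_ringX => //; apply: regular_subV.
Qed.

Lemma pole_at0 x : exists m, R z (t ^+ m * x).
Proof.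
have [->|x0] := eqVneq x 0; first by exists 0%N; rewrite mulr0; apply: local_ring0.
have [e [u [[_ Ru _] ->]]] := factor_at z x0; rewrite local_param0.
case: e => m.
  exists 0%N; rewrite expr0 mul1r; apply: local_ringM => //.
  by apply: local_ringX => //; apply: regular_poly.
by exists m.+1; rewrite NegzE -exprnN mulrA mulfV // mul1r.
Qed.

Lemma polarP n : polar n -> exists p m, n = emb p / t ^+ m /\ (size p <= m.+1)%N.
Proof.
move=> Pn; have [m Rm] := pole_at0 n.
have [a|p Ep] := @poly_of_regular (t ^+ m * n).
  have [->//|a0] := eqVneq a 0.
  apply: local_ringM => //; last by apply: Pn => -[/eqP]; rewrite (negPf a0).
  by rewrite -rmorphXn; apply: regular_poly.
exists p, m; have En : n = emb p / t ^+ m by rewrite -Ep mulrC mulKf.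
by split=> //; apply: regular_infty_size; rewrite -En; apply: Pn.
Qed.

Lemma polar_frac p m : (size p <= m.+1)%N -> polar (emb p / t ^+ m).
Proof.
move=> le_m [a|] ne_z.
  apply/regularP; exists p, 'X^m; rewrite rmorphXn; split=> //.
  by rewrite hornerXn expf_neq0 //; apply: contra_notN ne_z => /eqP->.
by exists p, 'X^m; rewrite size_polyXn rmorphXn expf_neq0 ?polyX_eq0.
Qed.

Lemma polar_regular_eq0 n c y : polar n -> R z y -> t^-1 * n + c%:K + t * y = 0 -> c = 0.
Proof.
move=> /polarP[p [m [-> le_p]]] /regularP[a [b [b0 ->]]] E.
have b1 : b != 0 by apply: contra_neq b0 => ->; rewrite horner0.
have Epoly : p * b = 'X^(m.+1) * (- (c *: b + 'X * a)).
  apply: emb_inj; rewrite -mul_polyC !(rmorphM, rmorphN, rmorphD, rmorphXn).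
  have b1' : emb b != 0 by rewrite emb_eq0.
  have : t ^+ m.+1 * emb b * (t^-1 * (emb p / t ^+ m) + c%:K + t * (emb a / emb b)) = 0.
    by rewrite E mulr0.
  move=> E2; apply/eqP; rewrite -subr_eq0; apply/eqP; rewrite -[RHS]E2 exprS.
  by have tm0 := tXn_neq0 m; field; rewrite ?b1' ?tm0 ?tX_neq0.
have Xp : 'X^(m.+1) %| p.
  have cop : coprimep 'X^(m.+1) b.
    by apply: coprimep_expl; rewrite coprimep_sym -['X]subr0 -polyC0 coprimep_XsubC.
  by rewrite -(Gauss_dvdpl p cop) Epoly dvdp_mulIl.
have p0 : p = 0.
  apply: contraTeq Xp => p0; rewrite gtNdvdp // size_polyXn ltnS.
  exact: le_p.
have : c *: b + 'X * a = 0.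
  apply/eqP; move/eqP: Epoly; rewrite p0 mul0r eq_sym mulf_eq0 expf_eq0 polyX_eq0 andbF /=.
  by rewrite oppr_eq0.
move/(congr1 (horner^~ 0)); rewrite !(hornerD, hornerM, hornerZ, hornerX, horner0) mul0r addr0 => /eqP.
by rewrite mulf_eq0 (negPf b0) orbF => /eqP.
Qed.

(* The coefficient of t^0 in the expansion at t = 0: K is the direct sum of
   t^-1 k[1/t], k and t R. *)
Definition cterm x : k :=
  xget 0 [set c | exists n y, [/\ polar n, R z y & x = t^-1 * n + c%:K + t * y]].

Lemma cterm_split x :
  exists n y, [/\ polar n, R z y & x = t^-1 * n + (cterm x)%:K + t * y].
Proof.
suff : exists c n y, [/\ polar n, R z y & x = t^-1 * n + c%:K + t * y] by move/xgetPex; apply.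
have [n [Rn Pn]] := principal_part z (t * x).
have [c1 [y1 [Ry1 E1]]] := regular_split Rn; have [c [y [Ry E]]] := regular_split Ry1.
exists c, (n + c1%:K), y; split=> //; first by apply: polarD => //; apply: polarC.
apply: (mulfI tX_neq0); rewrite -[LHS](subrK n) E1 E local_param0.
by field.
Qed.

Lemma ctermE n c y : polar n -> R z y -> cterm (t^-1 * n + c%:K + t * y) = c.
Proof.
move=> Pn Ry; have [n' [y' [Pn' Ry' E]]] := cterm_split (t^-1 * n + c%:K + t * y).
set c' := cterm _ in E *; apply/eqP; rewrite -subr_eq0; apply/eqP.
apply: (@polar_regular_eq0 (n' - n) _ (y' - y)).
- by apply: polarD => //; move=> Q Qz; apply: local_ringN => //; apply: Pn.
- exact: local_ringB.
move/eqP: E; rewrite eq_sym -subr_eq0 => /eqP E; rewrite -[RHS]E polyCB rmorphB /=.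
by field.
Qed.

Lemma cterm_lin c x y : cterm (c%:K * x + y) = c * cterm x + cterm y.
Proof.
have [n [u [Pn Ru Ex]]] := cterm_split x; have [n' [u' [Pn' Ru' Ey]]] := cterm_split y.
rewrite {1}Ex {1}Ey -(@ctermE (c%:K * n + n') (c * cterm x + cterm y) (c%:K * u + u')).
- by congr cterm; rewrite polyCD polyCM rmorphD rmorphM /=; field.
- by apply: polarD => //; apply: polarM => //; apply: polarC.
by apply: local_ringD => //; apply: local_ringM => //; apply: local_ringC.
Qed.

Lemma cterm0 : cterm 0 = 0.
Proof. by have := cterm_lin (-1) 0 0; rewrite mulr0 addr0 mulN1r addNr. Qed.

Lemma ctermD x y : cterm (x + y) = cterm x + cterm y.
Proof. by have := cterm_lin 1 x y; rewrite polyC1 rmorph1 !mul1r. Qed.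

Lemma ctermZ c x : cterm (c%:K * x) = c * cterm x.
Proof. by have := cterm_lin c x 0; rewrite !addr0 cterm0 addr0. Qed.

Lemma cterm_const c : cterm c%:K = c.
Proof.
have := @ctermE 0 c 0; rewrite !mulr0 add0r addr0; apply; last exact: local_ring0.
by move=> Q _; apply: local_ring0.
Qed.

Lemma cterm_polar n : polar n -> cterm (n / t) = 0.
Proof.
move=> Pn; have := @ctermE n 0 0 Pn; rewrite polyC0 rmorph0 mulr0 !addr0 mulrC; apply.
exact: local_ring0.
Qed.

Lemma cterm_reg y : R z y -> cterm (t * y) = 0.
Proof.
move=> Ry; have := @ctermE 0 0 y; rewrite polyC0 rmorph0 mulr0 !add0r; apply=> //.
by move=> Q _; apply: local_ring0.
Qed.

Definition coeft (i : nat) x := cterm (x / t ^+ i).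

Lemma coeft_lin i c x y : coeft i (c%:K * x + y) = c * coeft i x + coeft i y.
Proof. by rewrite /coeft mulrDl -mulrA cterm_lin. Qed.

Lemma coeft0 i : coeft i 0 = 0.
Proof. by rewrite /coeft mul0r cterm0. Qed.

Lemma coeftD i x y : coeft i (x + y) = coeft i x + coeft i y.
Proof. by rewrite /coeft mulrDl ctermD. Qed.

Lemma coeftZ i c x : coeft i (c%:K * x) = c * coeft i x.
Proof. by rewrite /coeft -mulrA ctermZ. Qed.

Lemma coeftN i x : coeft i (- x) = - coeft i x.
Proof. by have := coeftZ i (-1) x; rewrite polyCN rmorphN polyC1 rmorph1 !mulN1r. Qed.

Lemma coeft_sum i (I : Type) (r : seq I) (f : I -> K) :
  coeft i (\sum_(j <- r) f j) = \sum_(j <- r) coeft i (f j).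
Proof. by apply: (big_morph (coeft i) (coeftD i) (coeft0 i)). Qed.

Lemma coeft_mulX i j x : coeft (i + j) (t ^+ j * x) = coeft i x.
Proof.
congr cterm; have := tXn_neq0 j; have := tXn_neq0 i; rewrite exprD => ti tj.
by field; rewrite ti tj.
Qed.

Lemma coeft_small i j y : R z y -> (i < j)%N -> coeft i (t ^+ j * y) = 0.
Proof.
move=> Ry lt_ij; rewrite -{1}(subnK (ltnW lt_ij)) exprD mulrC mulrA -[i in coeft i]add0n.
rewrite mulrAC -mulrA [_ * (_ * _)]mulrCA coeft_mulX /coeft expr0 divr1 -(prednK (_ : 0 < j - i)%N) ?subn_gt0 //.
rewrite exprS mulrCA; apply: cterm_reg; apply: local_ringM => //.
by rewrite -rmorphXn; apply: regular_poly.
Qed.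

Lemma coeft_Xn i j : coeft i (t ^+ j) = (i == j)%:R.
Proof.
case: ltngtP => [lt_ij|lt_ji|->]; last first.
- by rewrite /coeft divff // -(rmorph1 emb) -polyC1 cterm_const.
- rewrite /coeft -{1}(subnK lt_ji) addnS exprS exprD.
  have := cterm_polar (polarVt (i - j.+1)); congr (_ = 0); congr cterm.
  by have := tXn_neq0 j; have := tXn_neq0 (i - j.+1) => ? tj; field; apply/and3P.
- by rewrite -[t ^+ j]mulr1 coeft_small //; apply: local_ring1.
Qed.

Lemma emb_coef p : emb p = \sum_(j < size p) (p`_j)%:K * t ^+ j.
Proof.
rewrite {1}[p in LHS](esym (coefK p)) poly_def rmorph_sum; apply: eq_bigr => j _.
by rewrite -mul_polyC rmorphM rmorphXn.
Qed.

Lemma coeft_poly i p : coeft i (emb p) = p`_i.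
Proof.
rewrite emb_coef coeft_sum; under eq_bigr => j _ do rewrite coeftZ coeft_Xn.
have [lt_i|le_i] := ltnP i (size p); last first.
  rewrite nth_default // big1 // => j _; rewrite gtn_eqF ?mulr0 //.
  exact: leq_trans (ltn_ord j) le_i.
rewrite (bigD1 (Ordinal lt_i)) //= eqxx mulr1 big1 ?addr0 // => j.
by rewrite -val_eqE /= eq_sym => /negPf->; rewrite mulr0.
Qed.

Lemma coeft0_const c : coeft 0 c%:K = c.
Proof. by rewrite coeft_poly coefC. Qed.

Lemma regular0_split x : R z x -> exists y, R z y /\ x = (coeft 0 x)%:K + t * y.
Proof.
case/regular_split => c [y [Ry]]; rewrite local_param0 => ->; exists y; split=> //.
by rewrite coeftD coeft0_const -{2}[t]expr1 coeft_small // addr0.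
Qed.

Lemma regular_expand N x : R z x ->
  exists y, R z y /\ x = emb (\poly_(i < N) coeft i x) + t ^+ N * y.
Proof.
move=> Rx; elim: N => [|N [y [Ry Ex]]].
  by exists x; rewrite poly_def big_ord0 rmorph0 add0r mul1r.
have [v [Rv Ey]] := regular0_split Ry; exists v; split=> //.
have EN : coeft N x = coeft 0 y.
  by rewrite {1}Ex coeftD coeft_poly coef_poly ltnn add0r -{1}[N]add0n coeft_mulX.
rewrite [LHS]Ex {1}Ey -EN !poly_def big_ord_recr rmorphD /= -addrA; congr (_ + _).
by rewrite -mul_polyC rmorphM rmorphXn /= mulrDr exprS; ring.
Qed.

Lemma regular_lead x : R z x -> x != 0 -> exists i u, [/\ R z u, coeft 0 u != 0 & x = t ^+ i * u].
Proof.
move=> Rx x0; have [e [u [[u0 Ru RVu]]]] := factor_at z x0; rewrite local_param0.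
have nzu : coeft 0 u != 0.
  apply/eqP => cu; have [v [Rv]] := regular0_split Ru; rewrite cu polyC0 rmorph0 add0r => Eu.
  have := coeft_poly 0 1; rewrite coefC rmorph1 (_ : 1 = t ^+ 1 * (v * u^-1)); last first.
    by rewrite mulrA expr1 -Eu mulfV.
  rewrite coeft_small //=; last exact: (local_ringM _ Rv RVu).
  by move/eqP; rewrite eq_sym oner_eq0.
case: e => i Ex; first by exists i, u.
move: nzu; rewrite (_ : u = t ^+ i.+1 * x) ?coeft_small ?eqxx //.
by rewrite Ex NegzE -exprnN mulrA mulfV // mul1r.
Qed.

Lemma coeft0_frac p q : q.[0] != 0 -> coeft 0 (emb p / emb q) != 0 -> p.[0] != 0.
Proof.
move=> q0; apply: contra_neq => /eqP; rewrite -rootE => /factor_theorem[r ->].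
have -> : emb (r * ('X - 0%:P)) / emb q = t ^+ 1 * (emb r / emb q).
  by rewrite polyC0 subr0 rmorphM expr1 mulrAC mulrA mulrC mulrA mulrAC.
by rewrite coeft_small //; apply/regularP; exists r, q.
Qed.

Section Semigroup.
Variables (S : set nat) (c : nat).
Hypotheses (hS : semigroup_set S) (S_ge : forall i, (c <= i)%N -> S i).
Notation O := (local_ring_of S z).

Let S0 : S 0%N. Proof. by case: hS. Qed.
Let SD i j : S i -> S j -> S (i + j)%N. Proof. by case: hS => _; apply. Qed.

Lemma local_ring_poly p : semigroup_ring S p -> O (emb p).
Proof.
move=> Sp; exists p, 1; rewrite hornerC oner_neq0 rmorph1 divr1; split=> // _; split=> //.
exact: semigroup_ringC.
Qed.

Lemma conductor_sub y : R z y -> O (t ^+ c * y).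
Proof.
case/regularP => a [b [b0 ->]]; have [bn0 Rb RVb] := unit_at_poly b0.
have [w [Rw Ew]] := regular_expand c.+1 RVb.
set P := \poly_(_ < _) _ in Ew.
have EbP : emb (b * P) = 1 - t ^+ c.+1 * (emb b * w).
  by rewrite rmorphM; apply/eqP; rewrite eq_sym subr_eq -{1}(mulfV bn0) {1}Ew; apply/eqP; ring.
have bP i : (i <= c)%N -> (b * P)`_i = (i == 0)%:R.
  move=> le_i; rewrite -coeft_poly EbP coeftD coeftN coeft_small //; last exact: local_ringM.
  by rewrite oppr0 addr0 -(expr0 t) coeft_Xn.
have bP0 : (b * P).[0] != 0 by rewrite horner_coef0 bP // oner_neq0.
exists ('X^c * (a * P)), (b * P); split=> // [_|].
  split=> i; last first.
    case: (leqP i c) => [le_i|/ltnW/S_ge //].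
    by rewrite bP //; case: (i =P 0%N) => [->|] //; rewrite eqxx.
  by rewrite coefXnM; case: ltnP => [|/S_ge //]; rewrite eqxx.
have P0 : emb P != 0 by rewrite emb_eq0; apply: contra_neq bP0 => ->; rewrite mulr0 horner0.
by rewrite !rmorphM rmorphXn; field; rewrite P0 bn0.
Qed.

Lemma local_ringP x : O x <-> R z x /\ forall i, ~ S i -> coeft i x = 0.
Proof.
split=> [Ox|[Rx Sx]]; last first.
  have [y [Ry ->]] := regular_expand c Rx.
  apply: local_ringD => //; last exact: conductor_sub.
  apply: local_ring_poly => i; rewrite coef_poly; case: ltnP => // _; last by rewrite eqxx.
  by move=> xi; apply: contrapT => /Sx xi0; rewrite xi0 eqxx in xi.
have Rx := local_ring_sub Ox; split=> //.
case: Ox => p [q [/(_ erefl)[Sp Sq] q0 Ex]].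
have qn0 : emb q != 0 by rewrite emb_eq0; apply: contra_neq q0 => ->; rewrite horner0.
elim/ltn_ind => i IHi nSi.
have : coeft i (emb p) = 0.
  by rewrite coeft_poly; apply/eqP; apply: contra_notT nSi => /Sp.
have -> : emb p = emb q * x by rewrite Ex mulrC divfK.
rewrite (emb_coef q) mulr_suml coeft_sum.
have sq : (0 < size q)%N by rewrite size_poly_gt0 -emb_eq0.
rewrite (bigD1 (Ordinal sq)) //= -mulrA coeftZ expr0 mul1r big1 ?addr0 => [|j].
  by move/eqP; rewrite mulf_eq0 -horner_coef0 (negPf q0) => /eqP.
rewrite -val_eqE /= -lt0n => j0; rewrite -mulrA coeftZ.
have [->|/Sq Sj] := eqVneq q`_j 0; first by rewrite mul0r.
have [lt_ij|le_ji] := ltnP i j; first by rewrite coeft_small ?mulr0.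
rewrite -{1}(subnK le_ji) coeft_mulX IHi ?mulr0 //.
  by rewrite ltn_subrL j0; apply: leq_trans le_ji.
by apply: contra_not nSi => Sij; rewrite -(subnK le_ji); apply: SD.
Qed.

Lemma local_ring_inv u : O u -> coeft 0 u != 0 -> O u^-1.
Proof.
case=> p [q [/(_ erefl)[Sp Sq] q0 ->]] nz; exists q, p; rewrite invf_div; split=> //.
exact: coeft0_frac nz.
Qed.

Lemma local_ring_Xn i : S i -> O (t ^+ i).
Proof.
move=> Si; rewrite -rmorphXn; apply: local_ring_poly => j; rewrite coefXn.
by case: (j =P i) => [->|] //; rewrite eqxx.
Qed.

End Semigroup.

Lemma finite_irregular x : finite_set [set Q | ~ R Q x].
Proof.
have [p [q [q0 ->]]] := emb_frac x.
have [r Er] := closed_field_poly_normal q.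
apply: (@sub_finite_set _ _ [set` None :: map Some r]); last exact: finite_seq.
move=> [a|] /= nR; rewrite inE //=; apply/mapP; exists a => //.
apply: contrapT => /negP ar; apply: nR; apply/regularP; exists p, q; split=> //.
by rewrite Er hornerZ mulf_neq0 ?lead_coef_eq0 // -rootE root_prod_XsubC.
Qed.

Lemma finite_support (A : set (option k)) :
  finite_set A -> exists2 s : seq (option k), uniq s & forall Q, A Q -> Q \in s.
Proof.
by move=> /finite_seqP[s ->]; exists (undup s) => [|Q]; rewrite ?undup_uniq ?mem_undup.
Qed.

Lemma approximation (r : option k -> K) (s : seq (option k)) : exists f,
  forall Q, Q <> z -> (Q \in s -> R Q (r Q - f)) /\ (Q \notin s -> R Q f).
Proof.
elim: s => [|P s [f Hf]].
  by exists 0 => Q _; rewrite in_nil; split=> // _; apply: local_ring0.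
have [Ps|nPs] := boolP (P \in s).
  exists f => Q Qz; have [H1 H2] := Hf Q Qz; rewrite inE.
  split=> [/orP[/eqP EQ|/H1 //]|]; first by apply: H1; rewrite EQ.
  by rewrite negb_or => /andP[_ /H2].
have [y [Ry Py]] := principal_part P (r P).
exists (f + y) => Q Qz; have [H1 H2] := Hf Q Qz; rewrite inE.
case: eqP => [EQ|/Py Ryq] /=; split=> //.
- move=> _; have -> : r Q - (f + y) = r Q - y - f by ring.
  by rewrite EQ in H2 *; apply: local_ringB => //; apply: H2.
- by move=> /H1 Rr; rewrite opprD addrA; apply: local_ringB.
by move=> /H2 Rf; apply: local_ringD.
Qed.

Lemma list_generator Q (s : seq K) : has (fun y => y != 0) s ->
  exists w, [/\ w \in s, w != 0 & forall y, y \in s -> R Q (y / w)].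
Proof.
elim: s => // x s IHs /= /orP x_or; have [/IHs [w [ws w0 Rw]]|s0] := boolP (has (fun y => y != 0) s).
  have [Rx|[x0 [y [Ry Ey]]]] := regular_or_inv Q (x / w).
    by exists w; rewrite inE ws orbT w0; split=> // y; rewrite inE => /orP[/eqP->|/Rw].
  have xn0 : x != 0 by apply: contra_neq x0 => ->; rewrite mul0r.
  exists x; rewrite inE eqxx xn0; split=> // v; rewrite inE => /orP[/eqP->|/Rw Rv].
    by rewrite divff //; apply: local_ring1.
  have -> : v / x = v / w * (x / w)^-1 by field; rewrite w0 xn0.
  by rewrite Ey; apply: local_ringM => //; apply: local_ringM => //; apply: local_param_regular.
have x0 : x != 0 by case: x_or => // s1; rewrite s1 in s0.
exists x; rewrite inE eqxx x0; split=> // v; rewrite inE => /orP[/eqP->|vs].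
  by rewrite divff //; apply: local_ring1.
move/hasPn/(_ v vs): s0; rewrite negbK => /eqP->; rewrite mul0r; exact: local_ring0.
Qed.

Lemma twist Q w : w != 0 -> Q <> z ->
  exists h, unit_at Q (h / w) /\ forall P, P <> Q -> P <> z -> unit_at P h.
Proof.
move=> w0 Qz; have [e [u [Uu ->]]] := factor_at Q w0.
have [h0 [Uh0 Hh0]] : exists h0, unit_at Q (h0 / local_param Q) /\
    forall P, P <> Q -> P <> z -> unit_at P h0.
  have ut b : Some b <> z -> unit_at (Some b) t.
    by move=> bz; apply: unit_at_poly; rewrite hornerX; apply: contra_notN bz => /eqP->.
  case: Q Qz {Uu} => [a|] Qz; last first.
    exists t^-1; split; first by rewrite divff ?invr_eq0 //; apply: unit_at1.
    by case=> // b _ /ut; apply: unit_atV.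
  exists (emb ('X - a%:P) / t); split.
    have pi0 := local_param_neq0 (Some a); rewrite /= mulrAC divff // mul1r.
    exact: unit_atV (ut _ Qz).
  case=> [b ab /ut Ub|_ _]; last by apply: unit_at_infty; rewrite ?size_XsubC ?size_polyX ?polyXsubC_eq0.
  apply: unit_atM (unit_atV Ub); apply: unit_at_poly; rewrite hornerXsubC subr_eq0.
  by apply: contra_notN ab => /eqP->.
have pi0 := local_param_neq0 Q; have [u0 _ _] := Uu.
exists (h0 ^ e); split; last by move=> P PQ Pz; apply: unit_atXz; apply: Hh0.
have -> : h0 ^ e / (local_param Q ^ e * u) = (h0 / local_param Q) ^ e * u^-1.
  by rewrite invfM mulrA expfzMl exprz_inv -invr_expz.
by apply: unit_atM (unit_atV Uu); apply: unit_atXz.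
Qed.

Definition curve_of S : curve k := @Curve k K (emb \o polyC) (option k) (local_ring_of S).

Lemma local_ring_away S Q x : Q <> z -> local_ring_of S Q x <-> R Q x.
Proof.
by case: Q => [a|] // az; apply: local_ring_regular; apply: contra_notN az => /eqP->.
Qed.

(** * Cohomology *)

Section Cohomology.
Variables (S : set nat) (c : nat).
Hypotheses (hS : semigroup_set S) (S_ge : forall i, (c <= i)%N -> S i).
Notation C := (curve_of S).
Notation O := (local_ring_of S z).
Implicit Types (F : sheaf C) (r : option k -> K).

Let S0 : S 0%N. Proof. by case: hS. Qed.

Lemma away_generator F Q : torsion_free_rank1 F -> Q <> z ->
  exists w, w != 0 /\ forall x, F Q x <-> R Q (x / w).
Proof.
move=> [/(_ Q)[m [g [[i0 gi0] ->]]] _] Qz.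
have [|w [/codomP[i Ew] w0 Rw]] := @list_generator Q (codom g).
  by apply/hasP; exists (g i0); rewrite ?codom_f.
exists w; split=> // x; split=> [[a [Oa ->]]|Rx].
  rewrite mulr_suml; apply: local_ring_sum => // j _; rewrite -mulrA.
  apply: local_ringM => //; last by apply: Rw; apply: codom_f.
  exact: (proj1 (local_ring_away S (a j) Qz) (Oa j)).
exists (fun j => if j == i then x / w else 0); split=> [j|].
  by case: eqP => _; [apply/local_ring_away | apply: local_ring0].
rewrite (bigD1 i) //= eqxx big1 => [|j /negPf->]; last by rewrite mul0r.
by rewrite addr0 -Ew divfK.
Qed.

Lemma normalization F : torsion_free_rank1 F ->
  exists g, g != 0 /\ forall Q x, Q <> z -> F Q x <-> R Q (g * x).
Proof.
move=> tfF; have [_ /finite_support[s _ sF]] := tfF.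
suff [g [g0 Hg]] : exists g, g != 0 /\ forall Q, Q <> z ->
    (Q \in s -> forall x, F Q x <-> R Q (g * x)) /\ (Q \notin s -> unit_at Q g).
  exists g; split=> // Q x Qz; have [Hs Hns] := Hg Q Qz.
  have [/Hs //|/[dup] Qs /Hns[_ Rg RVg]] := boolP (Q \in s).
  have -> : F Q = local_ring_of S Q by apply: contrapT => /sF; rewrite (negPf Qs).
  rewrite local_ring_away //; split=> [Rx|Rgx]; first exact: local_ringM.
  by rewrite -(mulKf g0 x); apply: local_ringM.
elim: {sF}s => [|P s [g [g0 Hg]]].
  by exists 1; split=> [|Q _]; [exact: oner_neq0 | split=> // _; exact: unit_at1].
have [Pz|Pz] := pselect (P = z).
  exists g; split=> // Q Qz; rewrite inE; case: eqP => [EQ|_] /=; last exact: Hg.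
  by case: Qz; rewrite EQ.
have [Ps|nPs] := boolP (P \in s).
  exists g; split=> // Q Qz; rewrite inE; case: eqP => [EQ|_] /=; last exact: Hg.
  by split=> // _; have [H1 _] := Hg Q Qz; apply: H1; rewrite EQ.
have [w [w0 Hw]] := away_generator tfF Pz.
have [h [Uh Hh]] := twist (invr_neq0 w0) Pz.
have [h0 Rhw RVhw] := Uh.
have hn0 : h != 0 by apply: contra_neq h0 => ->; rewrite mul0r.
exists (g * h); split; first exact: mulf_neq0.
move=> Q Qz; have [H1 H2] := Hg Q Qz; rewrite inE.
case: (Q =P P) => [EQ|QP] /=; split=> //.
- move=> _ x; rewrite EQ in H2 *; rewrite Hw.
  have [_ Ug UVg] := unit_atM (H2 nPs) Uh.
  have -> : g * h * x = g * (h / w^-1) * (x / w) by rewrite invrK; field.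
  split=> [Rx|Rgx]; first exact: local_ringM.
  have := local_ringM (semigroup_setT) UVg Rgx; rewrite mulKf //.
  exact: mulf_neq0.
- move=> Qs x; rewrite (H1 Qs); have [_ Rh RVh] := Hh Q QP Qz.
  have -> : g * h * x = h * (g * x) by ring.
  split=> [Rx|Rgx]; first exact: local_ringM.
  by rewrite -(mulKf hn0 (g * x)); apply: local_ringM.
by move=> /H2 Ug; apply: unit_atM => //; apply: Hh.
Qed.

Lemma adele_lin a r r' : adele (C := C) r -> adele (C := C) r' ->
  adele (C := C) (a *: (r : option k -> K^o) + (r' : option k -> K^o)).
Proof.
move=> Ar Ar'; apply: (@sub_finite_set _ _
  ([set Q | ~ R Q a] `|` [set z] `|` [set Q | ~ local_ring_of S Q (r Q)]
   `|` [set Q | ~ local_ring_of S Q (r' Q)])).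
  move=> Q /= nO.
  have [Qz|Qz] := pselect (Q = z); first by left; left; right.
  have [Ra|] := pselect (R Q a); last by left; left; left.
  have [Or|] := pselect (local_ring_of S Q (r Q)); last by left; right.
  have [Or'|] := pselect (local_ring_of S Q (r' Q)); last by right.
  case: nO; apply: local_ringD => //.
  by apply/(local_ring_away S _ Qz); apply: local_ringM => //; apply/(local_ring_away S _ Qz).
by rewrite !finite_setU; split=> //; split=> //; split; [exact: finite_irregular | exact: finite_set1].
Qed.

Lemma adele_finite r (s : seq (option k)) : (forall Q, Q \notin s -> r Q = 0) -> adele (C := C) r.
Proof.
move=> r0; apply: (@sub_finite_set _ _ [set` s]); last exact: finite_seq.
by move=> Q /= nO; apply: contrapT => /negP/r0 rQ; apply: nO; rewrite rQ; apply: local_ring0.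
Qed.

Lemma adele0 : adele (C := C) 0.
Proof. exact: (@adele_finite _ [::]). Qed.

Lemma stalk_lin F Q a x y : torsion_free_rank1 F ->
  local_ring_of S Q a -> F Q x -> F Q y -> F Q (a * x + y).
Proof.
move=> [/(_ Q)[m [g [_ ->]]] _] Oa [b [Ob ->]] [b' [Ob' ->]].
exists (fun i => a * b i + b' i); split=> [i|].
  by apply: local_ringD => //; [apply: local_ringM | apply: Ob'] => //; apply: Ob.
by rewrite mulr_sumr -big_split; apply: eq_bigr => i _ /=; ring.
Qed.

Lemma stalk0 F Q : torsion_free_rank1 F -> F Q 0.
Proof.
move=> [/(_ Q)[m [g [_ ->]]] _]; exists (fun=> 0); split=> [i|]; first exact: local_ring0.
by rewrite big1 // => i _; rewrite mul0r.
Qed.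

Lemma stalkM F Q a x : torsion_free_rank1 F -> local_ring_of S Q a -> F Q x -> F Q (a * x).
Proof. by move=> tfF Oa Fx; rewrite -[a * x]addr0; apply: stalk_lin => //; apply: stalk0. Qed.

Lemma subspace_H0 F : torsion_free_rank1 F -> subspace (@H0 k C F).
Proof.
move=> tfF; split=> [Q|a x y Fx Fy Q]; first exact: stalk0.
by apply: (@stalk_lin F Q a%:K) => //; apply: local_ringC.
Qed.

Lemma subspace_H1zero F : torsion_free_rank1 F -> subspace (@H1zero k C F).
Proof.
move=> tfF; split=> [|a r r' [f Hf] [f' Hf']].
  by exists 0 => Q; rewrite subr0; apply: stalk0.
exists (a%:K * f + f') => Q.
have -> : (const C a *: r + r') Q - (a%:K * f + f') = a%:K * (r Q - f) + (r' Q - f').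
  have -> : (const C a *: r + r') Q = a%:K * r Q + r' Q by [].
  by ring.
by apply: stalk_lin => //; apply: local_ringC.
Qed.

Lemma subspace0 (V : lmodType K) : @subspace k C V [set 0].
Proof. by split=> // a x y -> ->; rewrite scaler0 addr0. Qed.

Definition splits r f := forall Q, Q <> z -> R Q (r Q - f).

Lemma adele_splits r : adele (C := C) r -> exists f, splits r f.
Proof.
move=> /finite_support[s _ Hs]; have [f Hf] := approximation r s; exists f => Q Qz.
have [H1 H2] := Hf Q Qz; have [/H1 //|Qs] := boolP (Q \in s).
apply: local_ringB (H2 Qs) => //; apply/(local_ring_away S _ Qz).
by apply: contrapT => /Hs; rewrite (negPf Qs).
Qed.

(* By [adele_splits], H1 is computed by K / (F_0 + k[1/t]); [tail r] represents the
   class of the adele r, well defined up to k[1/t]. *)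
Definition tail r := r z - xget 0 (splits r).

Lemma coeft_polar i n : (0 < i)%N -> polar n -> coeft i n = 0.
Proof.
case: i => // i _ Pn; rewrite /coeft exprSr invfM mulrA.
by apply: cterm_polar; apply: polarM => //; apply: polarVt.
Qed.

Lemma coeft_tail i r f : (0 < i)%N -> splits r f -> coeft i (tail r) = coeft i (r z - f).
Proof.
move=> i0 Hf; have Hf' : splits r (xget 0 (splits r)) by apply: xgetI Hf.
rewrite /tail; move: (xget _ _) Hf' => f' Hf'.
have -> : r z - f' = (r z - f) + (f - f') by ring.
rewrite coeftD [X in _ + X]coeft_polar ?addr0 // => Q Qz.
have -> : f - f' = (r Q - f') - (r Q - f) by ring.
by apply: local_ringB; [|apply: Hf' | apply: Hf].
Qed.

Lemma coeft_tail_lin i a r r' : (0 < i)%N -> adele (C := C) r -> adele (C := C) r' ->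
  coeft i (tail (a%:K *: (r : option k -> K^o) + (r' : option k -> K^o))) =
  a * coeft i (tail r) + coeft i (tail r').
Proof.
move=> i0 /adele_splits[f Hf] /adele_splits[f' Hf'].
rewrite (coeft_tail i0 Hf) (coeft_tail i0 Hf').
rewrite -coeft_lin (@coeft_tail _ _ (a%:K * f + f')) //.
  congr (coeft i _).
  have -> : (a%:K *: (r : option k -> K^o) + (r' : option k -> K^o)) z = a%:K * r z + r' z by [].
  by ring.
move=> Q Qz; have -> : (a%:K *: (r : option k -> K^o) + (r' : option k -> K^o)) Q = a%:K * r Q + r' Q by [].
have -> : a%:K * r Q + r' Q - (a%:K * f + f') = a%:K * (r Q - f) + (r' Q - f') by ring.
by apply: local_ringD (Hf' Q Qz) => //; apply: local_ringM (Hf Q Qz) => //; apply: local_ringC.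
Qed.

Definition delta_at0 x : option k -> K^o := fun Q => if Q == z then x else 0.

Lemma delta_at0_z x : delta_at0 x z = x.
Proof. by rewrite /delta_at0 eqxx. Qed.

Lemma delta_at0_away x Q : Q <> z -> delta_at0 x Q = 0.
Proof. by rewrite /delta_at0 => /eqP/negPf->. Qed.

Lemma adele_delta x : adele (C := C) (delta_at0 x).
Proof. by apply: (@adele_finite _ [:: z]) => Q; rewrite inE => /eqP/delta_at0_away. Qed.

Definition gen_poly (s : seq nat) (a : 'I_(size s) -> k) : K :=
  \sum_i (a i)%:K * t ^+ nth 0%N s i.

Lemma coeft_gen_nth (s : seq nat) (a : 'I_(size s) -> k) (i : 'I_(size s)) : uniq s ->
  coeft (nth 0%N s i) (gen_poly a) = a i.
Proof.
move=> us; rewrite coeft_sum (bigD1 i) //= coeftZ coeft_Xn eqxx mulr1 big1 ?addr0 // => j ji.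
by rewrite coeftZ coeft_Xn nth_uniq // eq_sym val_eqE (negPf ji) mulr0.
Qed.

Lemma coeft_gen_notin (s : seq nat) (a : 'I_(size s) -> k) n :
  n \notin s -> coeft n (gen_poly a) = 0.
Proof.
move=> ns; rewrite coeft_sum big1 // => i _; rewrite coeftZ coeft_Xn.
by case: eqP => [En|_]; [rewrite En mem_nth in ns | rewrite mulr0].
Qed.

Lemma gen_poly_regular (s : seq nat) (a : 'I_(size s) -> k) : R z (gen_poly a).
Proof.
apply: local_ring_sum => // i _; apply: local_ringM => //; first exact: local_ringC.
by rewrite -rmorphXn; apply: regular_poly.
Qed.

Lemma gen_polyE (s : seq nat) (a : 'I_(size s) -> k) : exists p, gen_poly a = emb p.
Proof.
exists (\sum_i (a i)%:P * 'X^(nth 0%N s i)); rewrite rmorph_sum; apply: eq_bigr => i _.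
by rewrite rmorphM rmorphXn.
Qed.

Lemma sum_scaled (s : seq nat) (a : 'I_(size s) -> k) (e : 'I_(size s) -> K^o) y :
  (forall i, e i = t ^+ nth 0%N s i * y) ->
  \sum_i const C (a i) *: e i = gen_poly a * y.
Proof.
move=> Ee; rewrite /gen_poly mulr_suml; apply: eq_bigr => i _; rewrite Ee.
have -> : const C (a i) *: (t ^+ nth 0%N s i * y : K^o) = (a i)%:K * (t ^+ nth 0%N s i * y) by [].
by rewrite mulrA.
Qed.

Lemma sum_delta d (a : 'I_d -> k) (e : 'I_d -> K) :
  \sum_i const C (a i) *: delta_at0 (e i) = delta_at0 (\sum_i const C (a i) *: (e i : K^o)).
Proof.
have scE i Q : (const C (a i) *: delta_at0 (e i)) Q = (a i)%:K * delta_at0 (e i) Q by [].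
apply/funext => Q; rewrite fct_sumE; have [->|Qz] := pselect (Q = z).
  by rewrite delta_at0_z; apply: eq_bigr => i _; rewrite scE delta_at0_z.
by rewrite delta_at0_away // big1 // => i _; rewrite scE delta_at0_away // mulr0.
Qed.

Definition line_bundle (j : nat) : sheaf C :=
  fun Q => if Q == z then [set x : K | O (t ^+ j * x)]%classic else local_ring_of S Q.

Lemma line_bundle_z j x : line_bundle j z x <-> O (t ^+ j * x).
Proof. by rewrite /line_bundle eqxx. Qed.

Lemma line_bundle_away j Q : Q <> z -> line_bundle j Q = local_ring_of S Q.
Proof. by rewrite /line_bundle => /eqP/negPf->. Qed.

Lemma line_bundle0 : line_bundle 0 = @structure_sheaf k C.
Proof.
apply/funext => Q; rewrite /line_bundle; case: eqP => [->|//].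
by apply/seteqP; split=> x /=; rewrite mul1r.
Qed.

Lemma line_bundle_tf j : torsion_free_rank1 (line_bundle j).
Proof.
split=> [Q|]; last first.
  apply: (@sub_finite_set _ _ [set z]); last exact: finite_set1.
  by move=> Q /=; apply: contra_notP => /line_bundle_away.
exists 1%N, (fun=> if Q == z then t ^- j else 1); split.
  by exists ord0; case: (Q == z); rewrite ?oner_neq0 ?invr_eq0.
apply/seteqP; split=> x.
  rewrite /line_bundle; case: eqP => [->|_] /= Ox.
    exists (fun=> t ^+ j * x); split=> // ; rewrite big_ord_recl big_ord0 addr0.
    by rewrite mulrAC mulfV // mul1r.
  by exists (fun=> x); split=> //; rewrite big_ord_recl big_ord0 addr0 mulr1.
case=> a [Oa ->]; rewrite big_ord_recl big_ord0 addr0 /line_bundle.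
case: eqP => [EQ|_] /=; last by rewrite mulr1; apply: Oa.
by rewrite mulrCA mulfV // mulr1; have := Oa ord0; rewrite EQ.
Qed.

Lemma polar_poly j u : polar u -> R z (t ^+ j * u) ->
  exists p, t ^+ j * u = emb p /\ (size p <= j.+1)%N.
Proof.
move=> Pu Ru; have [a|p Ep] := @poly_of_regular (t ^+ j * u).
  have [->//|/eqP a0] := eqVneq a 0.
  apply: local_ringM => //; first by rewrite -rmorphXn; apply: regular_poly.
  by apply: Pu => -[].
exists p; split=> //; apply: regular_infty_size.
by rewrite -Ep mulrC mulKf //; apply: Pu.
Qed.

Lemma H0_line_bundle j u : H0 (line_bundle j) u -> polar u /\ O (t ^+ j * u).
Proof.
move=> Hu; split; last exact/line_bundle_z.
by move=> Q Qz; have := Hu Q; rewrite line_bundle_away //; apply: local_ring_sub.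
Qed.

Lemma h0_line_bundle j :
  h0 (line_bundle j) = count (fun n => `[<S n>]) (iota 0 j.+1).
Proof.
rewrite -size_filter; set s := [seq n <- _ | _].
have us : uniq s by rewrite filter_uniq // iota_uniq.
have Ss (i : 'I_(size s)) : S (nth 0%N s i) /\ (nth 0%N s i <= j)%N.
  by have := mem_nth 0%N (ltn_ord i); rewrite mem_filter mem_iota => /andP[/asboolP].
pose e (i : 'I_(size s)) : K^o := t ^+ nth 0%N s i / t ^+ j.
have Esum (a : 'I_(size s) -> k) : \sum_i const C (a i) *: e i = gen_poly a / t ^+ j.
  exact: sum_scaled.
apply: (@dimq_eq _ C K^o _ _ _ e (fun i u => coeft (nth 0%N s i) (t ^+ j * u))).
- exact: subspace0.
- by case: (subspace_H0 (line_bundle_tf j)).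
- move=> i Q; have [Si le_ij] := Ss i.
  have [->|Qz] := pselect (Q = z).
    by apply/line_bundle_z; rewrite /e mulrC divfK //; apply: local_ring_Xn.
  rewrite line_bundle_away //; apply/local_ring_away => //.
  by rewrite /e -rmorphXn; apply: polar_frac Qz; rewrite size_polyXn.
- move=> u /H0_line_bundle[Pu Ou]; rewrite Esum.
  have [p [Ep le_p]] := polar_poly Pu (local_ring_sub Ou).
  set a := fun i => _; have [p' Ep'] := gen_polyE a.
  suff E : p = p' by rewrite /= Ep' -E -Ep mulrC mulKf // subrr.
  apply/polyP => i; rewrite -!coeft_poly -Ep -Ep'.
  have [i_s|i_s] := boolP (i \in s).
    have lt_i : (index i s < size s)%N by rewrite index_mem.
    by have := @coeft_gen_nth s a (Ordinal lt_i) us; rewrite /a /= nth_index.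
  rewrite coeft_gen_notin //; move: i_s; rewrite mem_filter mem_iota negb_and /= add0n.
  case/orP => [/asboolPn nSi|]; last first.
    by rewrite -leqNgt Ep coeft_poly => le_i; rewrite nth_default // (leq_trans le_p).
  by have [_] := proj1 (local_ringP hS S_ge _) Ou; apply.
move=> u a _ /= /eqP; rewrite subr_eq0 Esum => /eqP Eu i.
by rewrite Eu mulrC divfK // coeft_gen_nth.
Qed.

Lemma polar_split x : exists n v, [/\ polar n, R z v & x = n + t * v].
Proof.
have [n [v [Pn Rv Ex]]] := cterm_split x.
exists (t^-1 * n + (cterm x)%:K), v; split=> //; apply: polarD; last exact: polarC.
by apply: polarM => //; have := polarVt 1; rewrite expr1.
Qed.

Lemma h1_line_bundle j :
  h1 (line_bundle j) = count (fun n => ~~ `[<S n>]) (iota j.+1 c).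
Proof.
rewrite -size_filter; set s := [seq n <- _ | _].
have us : uniq s by rewrite filter_uniq // iota_uniq.
have Ss n : n \in s = ~~ `[<S n>] && (j < n)%N.
  rewrite mem_filter mem_iota; case: asboolP => //= nSn.
  by case: ltnP => // lt_jn; apply: contra_notT nSn; rewrite -leqNgt => ?; apply: S_ge; lia.
have jlt (i : 'I_(size s)) : (j < nth 0%N s i)%N.
  by have := mem_nth 0%N (ltn_ord i); rewrite Ss => /andP[].
pose e (i : 'I_(size s)) := delta_at0 (t ^+ nth 0%N s i / t ^+ j).
have Esum (a : 'I_(size s) -> k) : \sum_i const C (a i) *: e i = delta_at0 (gen_poly a / t ^+ j).
  by rewrite sum_delta; congr delta_at0; apply: sum_scaled.
have coefj (i : 'I_(size s)) y : coeft (nth 0%N s i) (t ^+ j * y) = coeft (nth 0%N s i - j) y.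
  by rewrite -{1}(subnK (ltnW (jlt i))) coeft_mulX.
have coef_tail (i : 'I_(size s)) r f : splits r f ->
    coeft (nth 0%N s i) (t ^+ j * tail r) = coeft (nth 0%N s i) (t ^+ j * (r z - f)).
  by move=> Hf; rewrite !coefj; apply: coeft_tail => //; rewrite subn_gt0.
apply: (@dimq_eq _ C _ _ _ _ e (fun i r => coeft (nth 0%N s i) (t ^+ j * tail r))).
- exact: subspace_H1zero (line_bundle_tf j).
- exact: adele0.
- by move=> i; apply: adele_delta.
- move=> r Ar; rewrite Esum; have [f Hf] := adele_splits Ar.
  have [n [v [Pn Rv Ey]]] := polar_split (r z - f).
  set a := fun i => _; exists (f + n) => Q.
  have -> : (r - delta_at0 (gen_poly a / t ^+ j)) Q = r Q - delta_at0 (gen_poly a / t ^+ j) Q by [].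
  have [->|Qz] := pselect (Q = z); last first.
    rewrite line_bundle_away // local_ring_away // delta_at0_away // subr0 opprD addrA.
    by apply: local_ringB => //; [apply: Hf | apply: Pn].
  apply/line_bundle_z; rewrite delta_at0_z.
  have -> : t ^+ j * (r z - gen_poly a / t ^+ j - (f + n)) = t ^+ j.+1 * v - gen_poly a.
    have -> : r z = n + t * v + f by rewrite -Ey subrK.
    by have tj := tXn_neq0 j; rewrite exprS; field.
  apply/(local_ringP hS S_ge); split.
    apply: local_ringB => //; last exact: gen_poly_regular.
    by apply: local_ringM => //; rewrite -rmorphXn; apply: regular_poly.
  move=> i nSi; rewrite coeftD coeftN; have [i_s|i_s] := boolP (i \in s).
    have lt_i : (index i s < size s)%N by rewrite index_mem.
    have := @coeft_gen_nth s a (Ordinal lt_i) us; rewrite /= nth_index // => ->.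
    rewrite /a (coef_tail (Ordinal lt_i) _ _ Hf) /= nth_index // Ey.
    have lt_ji : (j < i)%N by move: i_s; rewrite Ss => /andP[].
    suff -> : coeft i (t ^+ j * (n + t * v)) = coeft i (t ^+ j.+1 * v) by rewrite subrr.
    rewrite mulrDr coeftD -{1}(subnK (ltnW lt_ji)) coeft_mulX coeft_polar ?subn_gt0 //.
    by rewrite add0r mulrA -exprSr.
  rewrite coeft_gen_notin // subr0 coeft_small //; move: i_s; rewrite Ss negb_and negbK -leqNgt.
  by case/orP => [/asboolP|].
move=> r a Ar; rewrite Esum => -[f Hf] i.
have Hr : splits r f.
  move=> Q Qz; have := Hf Q; rewrite line_bundle_away // local_ring_away //.
  have -> : (r - delta_at0 (gen_poly a / t ^+ j)) Q = r Q - delta_at0 (gen_poly a / t ^+ j) Q by [].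
  by rewrite delta_at0_away // subr0.
have := Hf z; rewrite line_bundle_z.
have -> : (r - delta_at0 (gen_poly a / t ^+ j)) z = r z - delta_at0 (gen_poly a / t ^+ j) z by [].
rewrite delta_at0_z (coef_tail _ _ _ Hr).
have -> : t ^+ j * (r z - gen_poly a / t ^+ j - f) = t ^+ j * (r z - f) - gen_poly a.
  by have tj := tXn_neq0 j; field.
case/(local_ringP hS S_ge) => _ /(_ (nth 0%N s i)); rewrite coeftD coeftN coeft_gen_nth //.
move=> E; apply/esym/eqP; rewrite -subr_eq0 E //.
by have := mem_nth 0%N (ltn_ord i); rewrite Ss => /andP[/asboolP].
Qed.

Lemma integral_closureP x : integral_closure (C := C) z x <-> R z x.
Proof.
split=> [[p [mon_p Op px]]|Rx]; last first.
  have [v [Rv Ex]] := regular0_split Rx; set a := coeft 0 x in Ex.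
  (* [x - a] lies in the maximal ideal, so its high powers lie in O. *)
  pose q : {poly K} := map_poly (emb \o polyC) (('X - a%:P) ^+ c.+1).
  have sq : size q = c.+2 by rewrite size_map_poly size_exp_XsubC.
  have mq : q \is monic by rewrite map_monic monic_exp ?monicXsubC.
  exists (q + (- (t * v) ^+ c.+1)%:P); split.
  - by rewrite monicE lead_coefDl -?monicE // sq size_polyC; case: (_ != _).
  - move=> i; rewrite coefD coefC; apply: local_ringD => //.
      by rewrite coef_map; apply: local_ringC.
    case: eqP => _; last exact: local_ring0.
    apply: local_ringN => //; rewrite exprMn exprSr -mulrA; apply: (conductor_sub hS S_ge).
    apply: local_ringM => //; first exact: regular_poly.
    exact: local_ringX.
  rewrite rootE hornerD hornerC /q rmorphXn /= map_polyXsubC horner_exp hornerXsubC.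
  have -> : x - (emb \o polyC) a = t * v by rewrite {1}Ex addrC addKr.
  by rewrite subrr.
case: (regular_or_inv z x) => // -[x0 [y [Ry]]]; rewrite local_param0 => Ey.
have [n sp] : exists n, size p = n.+1.
  by case: (size p) (size_poly_gt0 p) => [|n _]; [rewrite monic_neq0 | exists n].
have := rootP px; rewrite horner_coef sp big_ord_recr /=.
have -> : p`_n = 1 by move/monicP: mon_p; rewrite /lead_coef sp.
rewrite mul1r => E; have : coeft 0 (t * (\sum_(i < n) p`_i * t ^+ (n - i.+1) * y ^+ (n - i))) = -1.
  have -> : t * (\sum_(i < n) p`_i * t ^+ (n - i.+1) * y ^+ (n - i)) = (-1)%:K.
    apply: (mulIf (expf_neq0 n x0)); rewrite polyCN polyC1 rmorphN1 mulN1r.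
    apply/eqP; rewrite -addr_eq0 -[X in _ == X]E; apply/eqP; congr (_ + _).
    rewrite mulr_sumr mulr_suml; apply: eq_bigr => i _.
    have -> : t * (p`_i * t ^+ (n - i.+1) * y ^+ (n - i)) = p`_i * x^-1 ^+ (n - i).
      by rewrite Ey exprMn -(subnSK (ltn_ord i)) [t ^+ _.+1]exprS; ring.
    have -> : x ^+ n = x ^+ (n - i) * x ^+ i by rewrite -exprD subnK // ltnW.
    by rewrite exprVn mulrA divfK // expf_neq0.
  by rewrite coeft0_const.
rewrite -{1}[t]expr1 coeft_small //.
  by move/eqP; rewrite eq_sym oppr_eq0 oner_eq0.
apply: local_ring_sum => // i _; apply: local_ringM => //; last exact: local_ringX.
apply: local_ringM => //; first by apply: local_ring_sub; apply: Op.
by rewrite -rmorphXn; apply: regular_poly.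
Qed.

Lemma dimq_coeft (U W : set K^o) (A : set nat) (N : nat) :
  @subspace k C K^o U -> @subspace k C K^o W ->
  (forall i, A i -> (i < N)%N /\ U (t ^+ i)) ->
  (forall u, U u -> (forall i, A i -> coeft i u = 0) -> W u) ->
  (forall u, W u -> forall i, A i -> coeft i u = 0) ->
  dimq (C := C) U W = count (fun n => `[<A n>]) (iota 0 N).
Proof.
move=> hU hW UA sepW vanW; rewrite -size_filter; set s := [seq n <- _ | _].
have us : uniq s by rewrite filter_uniq // iota_uniq.
have As n : n \in s = `[<A n>].
  by rewrite mem_filter mem_iota; case: asboolP => //= /UA[->].
have As_nth (i : 'I_(size s)) : A (nth 0%N s i).
  by apply/asboolP; rewrite -As mem_nth.
pose e (i : 'I_(size s)) : K^o := t ^+ nth 0%N s i.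
have Esum (a : 'I_(size s) -> k) : \sum_i const C (a i) *: e i = gen_poly a.
  by rewrite -[RHS]mulr1; apply: sum_scaled => i; rewrite mulr1.
apply: (@dimq_eq _ C K^o _ _ _ e (fun i u => coeft (nth 0%N s i) u)) => //.
- by case: hU.
- by move=> i; have [] := UA _ (As_nth i).
- move=> u Uu; rewrite Esum; apply: sepW.
    apply: subspaceB => //; rewrite -Esum; apply: subspace_sum => // i.
    by apply: subspaceZ => //; have [] := UA _ (As_nth i).
  move=> i Ai; have i_s : i \in s by rewrite As; apply/asboolP.
  have lt_i : (index i s < size s)%N by rewrite index_mem.
  set a := fun i => _; have := @coeft_gen_nth s a (Ordinal lt_i) us.
  by rewrite coeftD coeftN /= nth_index // => ->; rewrite /a /= nth_index // subrr.
move=> u a Uu; rewrite Esum => Wu i; have := vanW _ Wu _ (As_nth i).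
by rewrite coeftD coeftN coeft_gen_nth // => /eqP; rewrite subr_eq0 => /eqP.
Qed.

Lemma subspace_local_ring : @subspace k C K^o O.
Proof.
split=> [|a x y Ox Oy]; first exact: local_ring0.
by apply: (local_ringD _ _ Oy) => //; apply: (local_ringM _ _ Ox) => //; apply: local_ringC.
Qed.

Lemma delta_curve : delta (C := C) z = count (fun n => ~~ `[<S n>]) (iota 0 c).
Proof.
rewrite /delta (@dimq_coeft _ _ (~` S)%classic c).
- by apply: eq_count => n; rewrite asbool_neg.
- split=> [|a x y /integral_closureP Rx /integral_closureP Ry]; apply/integral_closureP.
    exact: local_ring0.
  by apply: (local_ringD _ _ Ry) => //; apply: (local_ringM _ _ Rx) => //; apply: local_ringC.
- exact: subspace_local_ring.
- move=> i nSi; split; first by rewrite ltnNge; apply/negP => /S_ge.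
  by apply/integral_closureP; rewrite -rmorphXn; apply: regular_poly.
- by move=> u /integral_closureP Ru Su; apply/(local_ringP hS S_ge).
by move=> u /(local_ringP hS S_ge)[_].
Qed.

Implicit Types g : K.

Lemma stalk_pole F g : torsion_free_rank1 F ->
  exists N, forall x, F z x -> R z (t ^+ N * (g * x)).
Proof.
move=> [/(_ z)[m [w [_ ->]]] _].
have /choice[N HN] := fun i : 'I_m => pole_at0 (g * w i).
exists (\sum_i N i)%N => x [a [Oa ->]]; rewrite !mulr_sumr; apply: local_ring_sum => // i _.
have -> : t ^+ (\sum_i N i) * (g * (a i * w i)) =
    t ^+ (\sum_(j | j != i) N j) * a i * (t ^+ N i * (g * w i)).
  by rewrite (bigD1 i) //= exprD; ring.
apply: local_ringM => //; apply: local_ringM => //; last exact: local_ring_sub (Oa i).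
by rewrite -rmorphXn; apply: regular_poly.
Qed.

Lemma stalk_neq0 F : torsion_free_rank1 F -> exists x, F z x /\ x != 0.
Proof.
move=> [/(_ z)[m [w [[i wi] ->]]] _]; exists (w i); split=> //.
exists (fun j => if j == i then 1 else 0); split=> [j|].
  by case: eqP => _; [apply: local_ring1 | apply: local_ring0].
by rewrite (bigD1 i) //= eqxx mul1r big1 ?addr0 // => j /negPf->; rewrite mul0r.
Qed.

Lemma polar_small_eq0 u : polar u -> R z u -> coeft 0 u = 0 -> u = 0.
Proof.
move=> Pu Ru cu; have [|p []] := @polar_poly 0 u Pu; first by rewrite mul1r.
rewrite mul1r => Ep le_p; rewrite Ep; apply/eqP; rewrite emb_eq0; apply/eqP/polyP => i.
rewrite coef0; case: i => [|i]; first by rewrite -coeft_poly -Ep.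
by rewrite nth_default // (leq_trans le_p).
Qed.

Lemma normalized_H0 F g u : (forall Q x, Q <> z -> F Q x <-> R Q (g * x)) ->
  H0 F u -> polar (g * u).
Proof. by move=> Hg Hu Q Qz; apply/Hg. Qed.

Lemma normalized_shift F g : torsion_free_rank1 F -> g != 0 ->
  (forall Q x, Q <> z -> F Q x <-> R Q (g * x)) -> (0 < h0 F)%N ->
  exists j, (forall x, F z x -> R z (t ^+ j * (g * x))) /\
    exists x, F z x /\ coeft 0 (t ^+ j * (g * x)) != 0.
Proof.
move=> tfF g0 Hg h0F.
have ex : exists N, `[< forall x, F z x -> R z (t ^+ N * (g * x)) >].
  by have [N HN] := stalk_pole g tfF; exists N; apply/asboolP.
have [[|j] /asboolP Hj min_j] := ex_minnP ex.
  exists 0%N; split=> //; apply: contrapT => no.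
  suff : (h0 F <= 0)%N by rewrite leqNgt h0F.
  apply: (@dimq_sep_le _ C K^o _ _ 0 (fun _ _ => 0)) => //.
  - exact: subspace0.
  - exact: subspace_H0.
  - by case.
  move=> u Hu _; have Fu := Hu z.
  apply: (mulfI g0); rewrite mulr0; apply: polar_small_eq0; first exact: normalized_H0 Hu.
    by rewrite -[g * u]mul1r -(expr0 t); apply: Hj.
  apply/eqP; apply: contrapT => /negP cu; case: no; exists u; split=> //.
  by rewrite expr0 mul1r.
exists j.+1; split=> //; apply: contrapT => no.
suff : (j.+1 <= j)%N by rewrite ltnn.
apply: min_j; apply/asboolP => x Fx.
have [v [Rv]] := regular0_split (Hj x Fx).
have -> : coeft 0 (t ^+ j.+1 * (g * x)) = 0.
  by apply/eqP; apply: contrapT => /negP cu; case: no; exists x.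
rewrite polyC0 rmorph0 add0r exprS -mulrA => /(mulfI tX_neq0) ->.
exact: Rv.
Qed.

Definition orders F g (j : nat) : set nat := fun i =>
  exists x u, [/\ F z x, R z u, coeft 0 u != 0 & t ^+ j * (g * x) = t ^+ i * u].

Lemma h0_le F g j : torsion_free_rank1 F -> g != 0 ->
  (forall Q x, Q <> z -> F Q x <-> R Q (g * x)) ->
  (forall x, F z x -> R z (t ^+ j * (g * x))) ->
  (h0 F <= count (fun i => `[< orders F g j i >]) (iota 0 j.+1))%N.
Proof.
move=> tfF g0 Hg Hj; rewrite -size_filter; set s := [seq n <- _ | _].
apply: (@dimq_sep_le _ C K^o _ _ _ (fun (i : 'I_(size s)) u => coeft (nth 0%N s i) (t ^+ j * (g * u)))).
- exact: subspace0.
- exact: subspace_H0.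
- move=> i a x y _ _; rewrite -coeft_lin; congr coeft.
  by have -> : (const C a *: (x : K^o) + y) = a%:K * x + y by []; ring.
move=> u Hu Hs; apply: (mulfI g0); rewrite mulr0; apply: (mulfI (tXn_neq0 j)); rewrite mulr0.
have [p [Ep le_p]] := polar_poly (normalized_H0 Hg Hu) (Hj u (Hu z)).
have [//|y0] := eqVneq (t ^+ j * (g * u)) 0.
have [i [v [Rv v0 Ei]]] := regular_lead (Hj u (Hu z)) y0.
have cv : coeft i (t ^+ j * (g * u)) = coeft 0 v by rewrite Ei -{1}[i]add0n coeft_mulX.
have i_s : i \in s.
  rewrite mem_filter mem_iota /= add0n; apply/andP; split.
    by apply/asboolP; exists u, v.
  rewrite ltnNge; apply/negP => le_i; move: v0.
  by rewrite -cv Ep coeft_poly nth_default ?eqxx // (leq_trans le_p).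
have lt_i : (index i s < size s)%N by rewrite index_mem.
by have := Hs (Ordinal lt_i); rewrite /= nth_index // cv => v00; rewrite v00 eqxx in v0.
Qed.

Lemma h1_le F g j : torsion_free_rank1 F -> g != 0 ->
  (forall Q x, Q <> z -> F Q x <-> R Q (g * x)) -> orders F g j 0%N ->
  (h1 F <= count (fun i => ~~ `[< orders F g j i >]) (iota j.+1 c))%N.
Proof.
move=> tfF g0 Hg; set V := orders F g j => V0.
pose M y := F z (y / (t ^+ j * g)).
have tg0 : t ^+ j * g != 0 by rewrite mulf_neq0.
have Mlin a x y : O a -> M x -> M y -> M (a * x + y).
  by move=> Oa Mx My; rewrite /M mulrDl -mulrA; apply: stalk_lin.
have M0 : M 0 by rewrite /M mul0r; apply: stalk0.
have MV i : V i -> exists u, [/\ R z u, coeft 0 u != 0 & M (t ^+ i * u)].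
  move=> [x [u [Fx Ru u0 E]]]; exists u; split=> //.
  by rewrite /M -E mulrA mulrC mulKf.
have Mtail N v : (c <= N)%N -> R z v -> M (t ^+ N * v).
  move=> le_cN Rv; have [u [Ru u0 Mu]] := MV 0%N V0; rewrite expr0 mul1r in Mu.
  have RVu : R z u^-1 by apply: (@local_ring_inv setT).
  have -> : t ^+ N * v = t ^+ c * (t ^+ (N - c) * v * u^-1) * u + 0.
    have un0 : u != 0 by apply: contra_neq u0 => ->; rewrite coeft0.
    by rewrite addr0 -{1}(subnKC le_cN) exprD; field.
  apply: Mlin => //; apply: (conductor_sub hS S_ge).
  by do 2!apply: local_ringM => //; rewrite -rmorphXn; apply: regular_poly.
have reduce n : forall i v, (c <= i + n)%N -> R z v -> exists a : nat -> k,
    M (t ^+ i * v - \sum_(m <- [seq m <- iota i n | ~~ `[<V m>]]) (a m)%:K * t ^+ m).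
  elim: n => [|n IHn] i v le_c Rv.
    by exists (fun=> 0); rewrite big_nil subr0; apply: Mtail; rewrite // -[i]addn0.
  have [w [Rw Ew]] := regular0_split Rv.
  rewrite /=; case: asboolP => [Vi|nVi] /=.
    have [u [Ru u0 Mu]] := MV i Vi; have [u' [Ru' Eu]] := regular0_split Ru.
    pose b := coeft 0 v / coeft 0 u.
    have [||a Ma] := IHn i.+1 (w - b%:K * u'); first by rewrite addSnnS.
      by apply: local_ringB => //; apply: local_ringM => //; apply: local_ringC.
    exists a; have := Mlin b%:K _ _ (local_ringC _ _ S0) Mu Ma.
    set Sg := \sum_(_ <- _) _.
    suff -> : b%:K * (t ^+ i * u) + (t ^+ i.+1 * (w - b%:K * u') - Sg) = t ^+ i * v - Sg by [].
    rewrite Ew {1}Eu exprS.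
    have -> : (coeft 0 v)%:K = b%:K * (coeft 0 u)%:K by rewrite -rmorphM -polyCM /b divfK.
    by ring.
  have [|a Ma] := IHn i.+1 w _ Rw; first by rewrite addSnnS.
  exists (fun m => if m == i then coeft 0 v else a m); rewrite big_cons eqxx.
  suff -> : \sum_(m <- [seq m <- iota i.+1 n | ~~ `[<V m>]])
      (if m == i then coeft 0 v else a m)%:K * t ^+ m
    = \sum_(m <- [seq m <- iota i.+1 n | ~~ `[<V m>]]) (a m)%:K * t ^+ m.
    move: Ma; set Sg := \sum_(_ <- _) _.
    suff -> : t ^+ i.+1 * w - Sg = t ^+ i * v - ((coeft 0 v)%:K * t ^+ i + Sg) by [].
    by rewrite {1}Ew exprS; ring.
  apply: eq_big_seq => m; rewrite mem_filter mem_iota => /and3P[_ lt_im _].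
  by rewrite gtn_eqF.
rewrite -size_filter; set s := [seq n <- _ | _].
apply: (@dimq_span_le _ C _ _ _ _ (fun i : 'I_(size s) => delta_at0 (t ^+ nth 0%N s i / (t ^+ j * g)))).
- exact: subspace_H1zero.
- exact: adele0.
move=> r Ar; have Agr := adele_lin g Ar adele0.
have [f Hf] := adele_splits Agr.
have [n [v [Pn Rv Ey]]] := polar_split (g * r z - f).
have [a Ma] := reduce c j.+1 v (leq_addl _ _) Rv.
exists (fun i => a (nth 0%N s i)); rewrite sum_delta.
have -> : \sum_(i < size s) const C (a (nth 0%N s i)) *: (t ^+ nth 0%N s i / (t ^+ j * g) : K^o)
    = (\sum_(m <- s) (a m)%:K * t ^+ m) / (t ^+ j * g).
  by rewrite (@sum_scaled s _ _ (t ^+ j * g)^-1) // (big_nth 0%N) big_mkord.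
move: Ma; rewrite -/s; set Sg := \sum_(_ <- _) _ => Ma.
exists (g^-1 * (f + n)) => Q.
have -> : (r - delta_at0 (Sg / (t ^+ j * g))) Q = r Q - delta_at0 (Sg / (t ^+ j * g)) Q by [].
have [->|Qz] := pselect (Q = z); last first.
  rewrite delta_at0_away // subr0; apply/Hg => //.
  have -> : g * (r Q - g^-1 * (f + n)) = g * r Q - f - n by field.
  apply: local_ringB (Pn Q Qz) => //.
  have := Hf Q Qz; have -> : (g *: (r : option k -> K^o) + 0) Q = g * r Q + 0 by [].
  by rewrite addr0.
rewrite delta_at0_z; move: Ma; rewrite /M.
congr (F z _); have -> : r z = g^-1 * (n + t * v + f) by rewrite -Ey subrK mulKf.
by have tj := tXn_neq0 j; rewrite exprS; field; rewrite tj g0.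
Qed.

(** * Serre duality *)

Lemma orders_shift F g j i s : torsion_free_rank1 F ->
  orders F g j i -> S s -> orders F g j (i + s)%N.
Proof.
move=> tfF [x [u [Fx Ru u0 E]]] Ss; exists (t ^+ s * x), u; split=> //.
  by apply: stalkM => //; apply: local_ring_Xn.
have -> : t ^+ j * (g * (t ^+ s * x)) = t ^+ s * (t ^+ j * (g * x)) by ring.
by rewrite E mulrA -exprD addnC.
Qed.

Definition dual_sheaf : sheaf C :=
  fun Q => if Q == z then [set w : K | forall y, O y -> coeft 1 (w * y) = 0]%classic
           else local_ring_of S Q.

(* The residue at t = 0 of [tail r] times dt / t^2. *)
Definition trace (r : option k -> K^o) : k := coeft 1 (tail r).

Lemma dual_sheaf_z w : dual_sheaf z w <-> forall y, O y -> coeft 1 (w * y) = 0.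
Proof. by rewrite /dual_sheaf eqxx. Qed.

Lemma dual_sheaf_away Q : Q <> z -> dual_sheaf Q = local_ring_of S Q.
Proof. by rewrite /dual_sheaf => /eqP/negPf->. Qed.

Lemma trace_splits r f : splits r f -> trace r = coeft 1 (r z - f).
Proof. exact: coeft_tail. Qed.

Lemma trace_scale_delta (f x : K) : trace (f *: delta_at0 x) = coeft 1 (f * x).
Proof.
rewrite (@trace_splits _ 0).
  by rewrite subr0 -[in RHS](delta_at0_z x).
move=> Q Qz; have -> : (f *: delta_at0 x) Q = f * delta_at0 x Q by [].
by rewrite delta_at0_away // mulr0 subr0; apply: local_ring0.
Qed.

Lemma trace_H1dual : H1dual dual_sheaf trace.
Proof.
split=> [a r s Ar As|r Ar [f Hf]]; first exact: coeft_tail_lin.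
have Hs : splits r f.
  by move=> Q Qz; have := Hf Q; rewrite dual_sheaf_away // local_ring_away.
rewrite (trace_splits Hs); have /dual_sheaf_z/(_ 1) := Hf z; rewrite mulr1; apply.
exact: local_ring1.
Qed.

Lemma trace_unique (f f' : K) :
  (forall r : option k -> K^o, adele (C := C) r -> trace (f *: r) = trace (f' *: r)) -> f = f'.
Proof.
move=> Etr; apply/eqP; rewrite -subr_eq0; apply/negPn/negP => ff'.
have := Etr _ (adele_delta (t / (f - f'))); rewrite !trace_scale_delta => /eqP.
rewrite -subr_eq0 -coeftN -coeftD -mulrBl mulrC divfK // -[t]expr1 coeft_Xn eqxx.
by rewrite oner_eq0.
Qed.

Lemma polar_expand N x : exists n w, [/\ polar n, R z w &
  x = n + \sum_(i < N) (coeft i.+1 x)%:K * t ^+ i.+1 + t ^+ N.+1 * w].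
Proof.
have [n [v [Pn Rv Ex]]] := polar_split x; have [w [Rw Ev]] := regular_expand N Rv.
exists n, w; split=> //; rewrite {1}Ex {1}Ev -addrA; congr (_ + _).
rewrite mulrDr exprS mulrA; congr (_ + _).
rewrite poly_def rmorph_sum mulr_sumr; apply: eq_bigr => i _.
rewrite -mul_polyC rmorphM rmorphXn /=.
have -> : coeft i.+1 x = coeft i v.
  by rewrite Ex coeftD coeft_polar // add0r -[t]expr1 -addn1 coeft_mulX.
by rewrite exprS; ring.
Qed.

Lemma stalk_tail F g : torsion_free_rank1 F -> g != 0 ->
  exists N, forall y, R z y -> F z (g^-1 * (t ^+ N * y)).
Proof.
move=> tfF g0; have [x [Fx x0]] := stalk_neq0 tfF.
have [m Rm] := pole_at0 (g * x).
have [i [u [Ru u0 E]]] := regular_lead Rm (mulf_neq0 (tXn_neq0 m) (mulf_neq0 g0 x0)).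
exists (i + c)%N => y Ry.
have un0 : u != 0 by apply: contra_neq u0 => ->; rewrite coeft0.
have -> : g^-1 * (t ^+ (i + c) * y) = t ^+ c * (t ^+ m * u^-1 * y) * x.
  have -> : t ^+ (i + c) * y = t ^+ c * (t ^+ i * u) * u^-1 * y by rewrite exprD; field.
  by rewrite -E; field; rewrite un0 g0.
apply: stalkM => //; apply: (conductor_sub hS S_ge).
apply: local_ringM => //; apply: local_ringM => //.
  by rewrite -rmorphXn; apply: regular_poly.
exact: (@local_ring_inv setT).
Qed.

Lemma serre_duality F phi : torsion_free_rank1 F -> H1dual F phi ->
  exists f : K, Defs.Hom F dual_sheaf f /\
    forall r : option k -> K^o, adele (C := C) r -> phi r = trace (f *: r).
Proof.
move=> tfF [phi_lin phi0]; have [g [g0 Hg]] := normalization tfF.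
have [N HN] := stalk_tail tfF g0.
pose psi x := phi (delta_at0 (g^-1 * x)).
have deltaD a x y : delta_at0 (g^-1 * (a%:K * x + y)) =
    const C a *: delta_at0 (g^-1 * x) + delta_at0 (g^-1 * y).
  apply/funext => Q; have -> : (const C a *: delta_at0 (g^-1 * x) + delta_at0 (g^-1 * y)) Q =
    a%:K * delta_at0 (g^-1 * x) Q + delta_at0 (g^-1 * y) Q by [].
  have [->|Qz] := pselect (Q = z); first by rewrite !delta_at0_z; ring.
  by rewrite !delta_at0_away // mulr0 addr0.
have psi_lin a x y : psi (a%:K * x + y) = a * psi x + psi y.
  by rewrite /psi deltaD phi_lin //; apply: adele_delta.
have psi0 : psi 0 = 0 by have := psi_lin (-1) 0 0; rewrite mulr0 addr0 mulN1r addNr.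
have psiD x y : psi (x + y) = psi x + psi y.
  by have := psi_lin 1 x y; rewrite polyC1 rmorph1 !mul1r.
have psiZ a x : psi (a%:K * x) = a * psi x by have := psi_lin a x 0; rewrite psi0 !addr0.
have psi_stalk x : F z (g^-1 * x) -> psi x = 0.
  move=> Fx; apply: phi0; first exact: adele_delta.
  exists 0 => Q; rewrite subr0; have [->|Qz] := pselect (Q = z); first by rewrite delta_at0_z.
  by rewrite delta_at0_away //; apply: stalk0.
have psi_polar n : polar n -> psi n = 0.
  move=> Pn; apply: phi0; first exact: adele_delta.
  exists (g^-1 * n) => Q; have [->|Qz] := pselect (Q = z).
    by rewrite delta_at0_z subrr; apply: stalk0.
  by rewrite delta_at0_away // sub0r; apply/Hg => //; rewrite mulrN mulVKf //;
    apply: local_ringN => //; apply: Pn.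
pose f0 := \sum_(i < N) (psi (t ^+ i.+1))%:K * t ^- i.
have Pf0 : polar f0.
  move=> Q Qz; apply: local_ring_sum => // i _; apply: local_ringM => //; first exact: local_ringC.
  exact: polarVt.
have psiE x : psi x = coeft 1 (f0 * x).
  have -> : coeft 1 (f0 * x) = \sum_(i < N) psi (t ^+ i.+1) * coeft i.+1 x.
    rewrite mulr_suml coeft_sum; apply: eq_bigr => i _; rewrite -mulrA coeftZ.
    by congr (_ * _); rewrite -(coeft_mulX 1 i) mulrA mulfV // mul1r add1n.
  have [n [w [Pn Rw Ex]]] := polar_expand N x.
  rewrite {1}Ex !psiD psi_polar // add0r.
  have -> : psi (t ^+ N.+1 * w) = 0.
    apply: psi_stalk; rewrite exprSr -mulrA; apply: HN.
    by apply: local_ringM => //; apply: regular_poly.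
  rewrite addr0 (big_morph psi psiD psi0); apply: eq_bigr => i _.
  by rewrite psiZ mulrC.
exists (f0 * g); split.
  move=> Q x Fx; have [Ez|Qz] := pselect (Q = z).
    rewrite Ez in Fx *; apply/dual_sheaf_z => y Oy.
    have -> : f0 * g * x * y = f0 * (g * (y * x)) by ring.
    by rewrite -psiE; apply: psi_stalk; rewrite mulKf //; apply: stalkM.
  rewrite dual_sheaf_away // local_ring_away // -mulrA.
  by apply: local_ringM (Pf0 Q Qz) _ => //; apply/Hg.
move=> r Ar; have Agr := adele_lin g Ar adele0.
have grE Q : (g *: (r : option k -> K^o) + 0) Q = g * r Q by apply: addr0.
have [f Hf] := adele_splits Agr.
have -> : trace ((f0 * g) *: r) = coeft 1 (f0 * (g * r z - f)).
  rewrite (@trace_splits _ (f0 * f)).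
    have -> : ((f0 * g) *: (r : option k -> K^o)) z = f0 * g * r z by [].
    by congr coeft; ring.
  move=> Q Qz; have -> : ((f0 * g) *: (r : option k -> K^o)) Q = f0 * g * r Q by [].
  have -> : f0 * g * r Q - f0 * f = f0 * (g * r Q - f) by ring.
  by apply: local_ringM (Pf0 Q Qz) _ => //; rewrite -grE; apply: Hf.
rewrite -psiE; apply/eqP; rewrite -subr_eq0; apply/eqP.
have := phi_lin (-1) (delta_at0 (g^-1 * (g * r z - f))) r (adele_delta _) Ar.
rewrite mulN1r => E; rewrite addrC; apply: etrans (esym E) _; apply: phi0.
  by apply: adele_lin => //; apply: adele_delta.
exists (g^-1 * f) => Q.
have -> : (const C (-1) *: delta_at0 (g^-1 * (g * r z - f)) + r) Q =
  (-1)%:K * delta_at0 (g^-1 * (g * r z - f)) Q + r Q by [].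
rewrite polyCN polyC1 rmorphN1 mulN1r.
have [->|Qz] := pselect (Q = z).
  rewrite delta_at0_z; have -> : - (g^-1 * (g * r z - f)) + r z - g^-1 * f = 0 by field.
  exact: stalk0.
rewrite delta_at0_away // oppr0 add0r; apply/Hg => //.
by rewrite mulrBr mulVKf // -grE; apply: Hf.
Qed.

(** * Pseudo-symmetric semigroups give Kunz curves *)

Section PseudoSymmetric.
Variable f : nat.
Hypotheses (S_half : ~ S f) (Ec : c = f.*2.+1).
Hypothesis S_sym : forall i, (i <= f.*2)%N -> i <> f -> S (f.*2 - i)%N <-> ~ S i.

Lemma frobenius_gap : ~ S f.*2.
Proof.
apply/S_sym => //; last by rewrite subnn.
move=> E; apply: S_half; rewrite (_ : f = 0%N) //.
by apply/eqP; rewrite -(eqn_add2l f) addn0 addnn E.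
Qed.

(* The stalk of the dualizing sheaf at t = 0 is t^(1-2f) (O + t^f O). *)
Lemma dual_sheaf_shift x :
  dual_sheaf z (t / t ^+ f.*2 * x) <-> forall y, O y -> coeft f.*2 (x * y) = 0.
Proof.
suff E y : coeft 1 (t / t ^+ f.*2 * x * y) = coeft f.*2 (x * y).
  by rewrite dual_sheaf_z; split=> H y /H; rewrite E.
by congr cterm; have tf := tXn_neq0 f.*2; field; rewrite tf tX_neq0.
Qed.

Lemma dual_stalk_sub x y : O x -> O y -> dual_sheaf z (t / t ^+ f.*2 * (x + t ^+ f * y)).
Proof.
move=> Ox Oy; apply/dual_sheaf_shift => w Ow; rewrite mulrDl coeftD -mulrA.
have [_ -> //] := proj1 (local_ringP hS S_ge _) (local_ringM hS Ox Ow); last exact: frobenius_gap.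
rewrite add0r -addnn coeft_mulX.
by have [_ ->] := proj1 (local_ringP hS S_ge _) (local_ringM hS Oy Ow).
Qed.

Lemma dual_stalk_sup x : dual_sheaf z (t / t ^+ f.*2 * x) ->
  exists y a, O y /\ x = y + t ^+ f * a%:K.
Proof.
move/dual_sheaf_shift => Hx.
have Hc i : (i <= f.*2)%N -> S (f.*2 - i)%N -> coeft i x = 0.
  move=> le_i /(local_ring_Xn hS) /Hx.
  by rewrite mulrC -{1}(subnKC le_i) coeft_mulX.
have Rx : R z x.
  have [//|[x0 [y [Ry Ey]]]] := regular_or_inv z x.
  have [m Rm] := pole_at0 x.
  have [i [u [Ru u0 E]]] := regular_lead Rm (mulf_neq0 (tXn_neq0 m) x0).
  have [le_mi|lt_im] := leqP m i.
    have -> : x = t ^+ (i - m) * u.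
      by apply: (mulfI (tXn_neq0 m)); rewrite E mulrA -exprD subnKC.
    by apply: local_ringM => //; rewrite -rmorphXn; apply: regular_poly.
  have Sm : S (f.*2 + (m - i))%N by apply: S_ge; rewrite Ec -addn1 leq_add2l subn_gt0.
  have := Hx _ (local_ring_Xn hS Sm).
  have -> : x * t ^+ (f.*2 + (m - i)) = t ^+ f.*2 * u.
    apply: (mulfI (tXn_neq0 i)); rewrite mulrCA -exprD addnCA subnKC ?(ltnW lt_im) //.
    by rewrite exprD mulrCA [x * _]mulrC E mulrCA.
  by rewrite -{1}[f.*2]add0n coeft_mulX => u00; rewrite u00 eqxx in u0.
exists (x - t ^+ f * (coeft f x)%:K), (coeft f x); split; last by rewrite subrK.
apply/(local_ringP hS S_ge); split.
  apply: local_ringB => //; apply: local_ringM => //; last exact: local_ringC.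
  by rewrite -rmorphXn; apply: regular_poly.
move=> i nSi; rewrite coeftD coeftN mulrC coeftZ coeft_Xn.
have [->|/eqP ne_if] := eqVneq i f; first by rewrite mulr1 subrr.
have le_i : (i <= f.*2)%N by rewrite leqNgt; apply/negP => lt_i; apply: nSi; apply: S_ge; rewrite Ec.
by rewrite mulr0 subr0 Hc //; apply/S_sym.
Qed.

Lemma dual_sheaf_tf : torsion_free_rank1 dual_sheaf.
Proof.
split=> [Q|]; last first.
  apply: (@sub_finite_set _ _ [set z]); last exact: finite_set1.
  by move=> Q /=; apply: contra_notP => /dual_sheaf_away.
have [->|Qz] := pselect (Q = z); last first.
  exists 1%N, (fun=> 1); split; first by exists ord0; rewrite oner_neq0.
  rewrite dual_sheaf_away //; apply/seteqP; split=> x.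
    by exists (fun=> x); split=> //; rewrite big_ord_recl big_ord0 addr0 mulr1.
  by case=> a [Oa ->]; rewrite big_ord_recl big_ord0 addr0 mulr1; apply: Oa.
pose g (i : 'I_2) := t / t ^+ f.*2 * t ^+ (i * f)%N.
have tn0 : t / t ^+ f.*2 != 0 by rewrite mulf_neq0 ?invr_eq0.
exists 2%N, g; split; first by exists ord0; rewrite /g mul0n expr0 mulr1.
apply/seteqP; split=> w.
  have -> : w = t / t ^+ f.*2 * (t ^+ f.*2 / t * w).
    by have tf := tXn_neq0 f.*2; field; rewrite tf tX_neq0.
  case/dual_stalk_sup => y [a [Oy ->]]; exists (fun i : 'I_2 => if i == ord0 then y else a%:K).
  split=> [i|]; first by case: eqP => _ //; apply: local_ringC.
  by rewrite 2!big_ord_recl big_ord0 /g /= mul0n expr0 mul1n; ring.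
case=> a [Oa ->].
have -> : \sum_i a i * g i = t / t ^+ f.*2 * (a ord0 + t ^+ f * a (lift ord0 ord0)).
  by rewrite 2!big_ord_recl big_ord0 /g /= mul0n expr0 mul1n; ring.
by apply: dual_stalk_sub; apply: Oa.
Qed.

Lemma dualizing_dual_sheaf : dualizing dual_sheaf trace.
Proof.
split; [exact: dual_sheaf_tf | exact: trace_H1dual |].
move=> F phi tfF Hphi; have [h [Hh Eh]] := serre_duality tfF Hphi.
exists h; split=> // h' [_ Eh']; apply: trace_unique => r Ar.
by rewrite -Eh // -Eh'.
Qed.

Lemma adeleZ a (r : option k -> K^o) : adele (C := C) r -> adele (C := C) (a *: r).
Proof. by move=> Ar; have := adele_lin a Ar adele0; rewrite addr0. Qed.

Lemma dualizing_unique W tr : dualizing (C := C) W tr ->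
  exists h, h != 0 /\ forall x, W z (h * x) <-> dual_sheaf z x.
Proof.
move=> [tfW trW dualW]; have [tfD trD dualD] := dualizing_dual_sheaf.
have [h [[Hh Eh] _]] := dualW _ _ tfD trD.
have [g [[Hg Eg] _]] := dualD _ _ tfW trW.
have gh1 : g * h = 1.
  apply: trace_unique => r Ar; by rewrite scale1r (Eh r Ar) (Eg _ (adeleZ h Ar)) scalerA.
have h0 : h != 0 by apply/eqP => h0; move/eqP: gh1; rewrite h0 mulr0 eq_sym oner_eq0.
exists h; split=> // x; split=> [/Hg|/Hh //].
by rewrite mulrA gh1 mul1r.
Qed.

Lemma Gorenstein_away Q : Q <> z -> Gorenstein_at (C := C) Q.
Proof.
move=> Qz; exists dual_sheaf, trace; split; first exact: dualizing_dual_sheaf.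
rewrite dual_sheaf_away //; exists 1%N, (fun=> 1); split=> [_|x Ox]; first exact: local_ring1.
exists [ffun=> x]; split.
  by split=> [i|]; rewrite ?big_ord_recl ?big_ord0 ffunE // addr0 mulr1.
move=> a [_ ->]; apply/ffunP => i; rewrite ffunE big_ord_recl big_ord0 addr0 mulr1.
by rewrite (ord1 i).
Qed.

(* Any two elements of K are linearly dependent over O, so a basis has one element. *)
Lemma free_stalk_cyclic F : torsion_free_rank1 F -> free_at (C := C) z (F z) ->
  exists b, F z b /\ forall x, F z x -> exists a, O a /\ x = a * b.
Proof.
move=> tfF [m [b [Fb Ub]]]; have [x [Fx x0]] := stalk_neq0 tfF.
case: m b Fb Ub => [|m] b Fb Ub.
  have [a [[_ Ex] _]] := Ub x Fx; move: x0; by rewrite Ex big_ord0 eqxx.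
exists (b ord0); split=> // y Fy.
have [a [[Oa ->] _]] := Ub y Fy.
have only (i : 'I_m.+1) : i = ord0.
  apply/eqP/negPn/negP => i0.
  have rep (l : 'I_m.+1) w : O w -> [/\ (forall j, O ([ffun j => if j == l then w else 0] j)) &
      w * b l = \sum_j ([ffun j => if j == l then w else 0] : {ffun 'I_m.+1 -> K}) j * b j].
    move=> Ow; split=> [j|]; first by rewrite ffunE; case: eqP => _ //; apply: local_ring0.
    rewrite (bigD1 l) //= ffunE eqxx big1 ?addr0 // => j /negPf jl.
    by rewrite ffunE jl mul0r.
  have [n Rn] := pole_at0 (b i / b ord0).
  have b0 l : b l != 0.
    apply/eqP => bl; have [a' [_ uniq_a]] := Ub (0 * b l) (stalkM tfF (local_ring0 _ S0) (Fb l)).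
    have E1 := uniq_a _ (rep l 0 (local_ring0 _ S0)).
    have [H1 H2] := rep l 1 (local_ring1 _ S0).
    have : a' = [ffun j => if j == l then 1 else 0].
      by apply: uniq_a; split=> //; rewrite -H2 bl !mulr0.
    rewrite E1 => /ffunP/(_ l); rewrite !ffunE eqxx => /eqP.
    by rewrite eq_sym oner_eq0.
  pose w := t ^+ c * t ^+ n; pose w' := t ^+ c * (t ^+ n * (b i / b ord0)).
  have Ow : O w by apply: (conductor_sub hS S_ge); rewrite -rmorphXn; apply: regular_poly.
  have Ow' : O w' by apply: (conductor_sub hS S_ge).
  have Eww' : w * b i = w' * b ord0 by rewrite /w /w'; have := b0 ord0 => b00; field.
  have [a' [_ uniq_a]] := Ub (w * b i) (stalkM tfF Ow (Fb i)).
  have E1 := uniq_a _ (rep i w Ow).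
  have : a' = [ffun j => if j == ord0 then w' else 0].
    by apply: uniq_a; have [? E] := rep ord0 w' Ow'; split=> //; rewrite Eww'.
  rewrite E1 => /ffunP/(_ i); rewrite !ffunE eqxx (negPf i0) => /eqP.
  by rewrite mulf_eq0 !expf_eq0 emb_eq0 polyX_eq0 !andbF.
exists (a ord0); split; first exact: Oa.
by rewrite (bigD1 ord0) //= big1 ?addr0 // => j; rewrite (only j) eqxx.
Qed.

Lemma not_Gorenstein0 : ~ Gorenstein_at (C := C) z.
Proof.
case=> W [tr [dW freeW]]; have [h [h0 HW]] := dualizing_unique dW.
have [tfW _ _] := dW.
have [b [Wb Hb]] := free_stalk_cyclic tfW freeW.
pose w0 := t / t ^+ f.*2.
have w00 : w0 != 0 by rewrite mulf_neq0 ?invr_eq0.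
have W1 : W z (h * (w0 * 1)).
  by apply/HW; have := dual_stalk_sub (local_ring1 _ S0) (local_ring0 _ S0); rewrite mulr0 addr0.
have Wf : W z (h * (w0 * t ^+ f)).
  apply/HW; have := dual_stalk_sub (local_ring0 _ S0) (local_ring1 _ S0).
  by rewrite mulr1 add0r.
pose x := b / (h * w0).
have Ebx : b = h * (w0 * x) by rewrite /x; field; rewrite h0 w00.
have [y [a [Oy Ex]]] : exists y a, O y /\ x = y + t ^+ f * a%:K.
  by apply: dual_stalk_sup; apply/HW; rewrite -Ebx.
have [a1 [Oa1 E1]] := Hb _ W1; have [a2 [Oa2 E2]] := Hb _ Wf.
have hw0 : h * w0 != 0 by rewrite mulf_neq0.
have a1x : a1 * x = 1.
  by apply: (mulfI hw0); rewrite -[RHS]mulrA E1 Ebx; ring.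
have a2x : a2 * x = t ^+ f.
  by apply: (mulfI hw0); rewrite -[RHS]mulrA E2 Ebx; ring.
have Rx : R z x.
  rewrite Ex; apply: local_ringD => //; first exact: local_ring_sub Oy.
  apply: local_ringM => //; last exact: local_ringC.
  by rewrite -rmorphXn; apply: regular_poly.
have Ox : O x.
  have a10 : coeft 0 a1 != 0.
    apply/eqP => ca1; have [v [Rv Ea]] := regular0_split (local_ring_sub Oa1).
    have := coeft_Xn 0 0; rewrite expr0 -a1x Ea ca1 polyC0 rmorph0 add0r -mulrA -[t]expr1.
    rewrite coeft_small //; last exact: local_ringM.
    by move/eqP; rewrite eqxx eq_sym oner_eq0.
  have -> : x = a1^-1.
    have a1n : a1 != 0 by apply: contra_neq a10 => ->; rewrite coeft0.
    by apply: (mulfI a1n); rewrite a1x mulfV.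
  exact: local_ring_inv.
have := local_ringM hS Oa2 Ox; rewrite a2x.
case/(local_ringP hS S_ge) => _ /(_ f S_half) /eqP.
by rewrite coeft_Xn eqxx oner_eq0.
Qed.

Lemma conductorP x : conductor (C := C) z x <-> O x /\ forall i, (i < c)%N -> coeft i x = 0.
Proof.
split=> [Hx|[Ox cx] y /integral_closureP Ry].
  have Ox : O x by have := Hx 1; rewrite mulr1; apply; apply/integral_closureP; apply: local_ring1.
  split=> // i lt_i; have le_i : (i <= f.*2)%N by rewrite -ltnS -Ec.
  have := Hx (t ^+ (f.*2 - i)); case.
    by apply/integral_closureP; rewrite -rmorphXn; apply: regular_poly.
  move=> p [q [pq q0 E]].
  have : O (x * t ^+ (f.*2 - i)) by exists p, q.
  case/(local_ringP hS S_ge) => _ /(_ _ frobenius_gap).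
  by rewrite mulrC -{1}(subnKC le_i) coeft_mulX.
have [v [Rv ->]] := regular_expand c (local_ring_sub Ox).
rewrite poly_def big1 => [|i _]; last by rewrite cx // scale0r.
rewrite rmorph0 add0r -mulrA; apply: (conductor_sub hS S_ge).
exact: local_ringM.
Qed.

Lemma count_semigroup : count (fun n => `[<S n>]) (iota 0 c) = f.
Proof.
rewrite (@count_iota _ 0 c c) // Ec; set B := fun n : nat => `[<S n>].
have -> : (\sum_(i < f.*2.+1) ((0 <= i < 0 + f.*2.+1) && B i) = \sum_(i < f.*2.+1) B i)%N.
  by apply: eq_bigr => i _; rewrite add0n ltn_ord.
have lt_f : (f < f.*2.+1)%N by rewrite ltnS -addnn leq_addr.
apply: double_inj; rewrite -[in LHS]addnn {1}(reindex_inj rev_ord_inj) /= -big_split /=.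
rewrite (bigD1 (Ordinal lt_f)) //= (eq_bigr (fun=> 1%N)) => [|i].
  have -> : B (f.*2.+1 - f.+1)%N = false by apply/asboolP; rewrite subSS -addnn addnK.
  have -> : B f = false by apply/asboolP.
  rewrite sum1_card !add0n; transitivity #|predC1 (Ordinal lt_f)|.
    by apply: eq_card => i; rewrite !inE.
  by rewrite cardC1 card_ord.
rewrite -val_eqE /= => /eqP ne_if.
have := S_sym (ltnSE (ltn_ord i)) ne_if; rewrite subSS /B.
by case: asboolP => ?; case: asboolP => ? //= ?; exfalso; tauto.
Qed.

Lemma count_gaps : count (fun n => ~~ `[<S n>]) (iota 0 c) = f.+1.
Proof.
have := count_predC (fun n => `[<S n>]) (iota 0 c).
rewrite count_semigroup size_iota Ec -addnn -addnS => /eqP.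
by rewrite eqn_add2l => /eqP.
Qed.

Lemma Kunz_curve : Kunz C.
Proof.
exists z; split=> [Q|].
  split=> [nG|->]; last exact: not_Gorenstein0.
  by apply: contrapT => /Gorenstein_away.
rewrite /eta delta_curve count_gaps.
rewrite (@dimq_coeft _ _ (fun i => S i /\ (i < c)%N) c).
- rewrite (_ : count _ _ = f); last first.
    rewrite -[RHS]count_semigroup; apply: eq_in_count => n; rewrite mem_iota add0n /= => lt_n.
    by apply: asbool_equiv_eq; split=> [[]|].
  by rewrite -addn1 PoszD addrC addKr.
- exact: subspace_local_ring.
- split=> [y _|a x y Hx Hy v Hv]; first by rewrite mul0r; apply: local_ring0.
  have -> : (const C a *: x + y) * v = a%:K * (x * v) + y * v.
    by have -> : const C a *: x = a%:K * x by []; ring.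
  apply: local_ringD (Hy v Hv) => //; apply: local_ringM (Hx v Hv) => //.
  exact: local_ringC.
- by move=> i [Si lt_i]; split=> //; apply: local_ring_Xn.
- move=> u Ou Hu; apply/conductorP; split=> // i lt_i.
  have [Si|nSi] := pselect (S i); first exact: Hu.
  by have [_] := proj1 (local_ringP hS S_ge _) Ou; apply.
by move=> u /conductorP[_ cu] i [_ lt_i]; apply: cu.
Qed.

Lemma sheaf_bound F : torsion_free_rank1 F -> (0 < h0 F)%N -> exists (V : pred nat) j,
  [/\ V 0%N, forall i s, V i -> S s -> V (i + s)%N,
      (h0 F <= count V (iota 0 j.+1))%N & (h1 F <= count (predC V) (iota j.+1 c))%N].
Proof.
move=> tfF h0F; have [g [g0 Hg]] := normalization tfF.
have [j [Rj [x [Fx x0]]]] := normalized_shift tfF g0 Hg h0F.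
have V0 : orders F g j 0%N by exists x, (t ^+ j * (g * x)); rewrite mul1r; split=> //; apply: Rj.
exists (fun i => `[< orders F g j i >]), j; split.
- exact/asboolP.
- by move=> i s /asboolP Vi Ss; apply/asboolP; apply: orders_shift.
- exact: h0_le.
exact: h1_le.
Qed.

Lemma h1_line_bundle_gaps j :
  (count (fun n => ~~ `[<S n>]) (iota 0 j.+1) + h1 (line_bundle j) = f.+1)%N.
Proof.
rewrite h1_line_bundle -count_cat -{2}[j.+1]add0n -iotaD addnC iotaD count_cat count_gaps.
rewrite -[RHS]addn0; congr addn; apply/eqP; rewrite -leqn0 leqNgt -has_count.
by apply/hasPn => i; rewrite mem_iota negbK add0n => /andP[/S_ge Si _]; apply/asboolP.
Qed.

Lemma Cliff_sheafE F :
  Cliff_sheaf F = f%:Z + 2 - (h0 F)%:Z - (h1 F)%:Z.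
Proof.
rewrite /Cliff_sheaf /deg /euler_char -line_bundle0 h0_line_bundle.
have := h1_line_bundle_gaps 0; rewrite /=.
have -> : `[<S 0%N>] = true by apply/asboolP.
rewrite /= !add0n => ->.
lia.
Qed.

End PseudoSymmetric.

End Cohomology.

(** * The Clifford index *)

Section Clifford.
Variables mu H : nat.
Hypotheses (mu_ge3 : (2 < mu)%N) (H_gt0 : (0 < H)%N) (mu_leH : (mu <= 2 * H + 1)%N).
Let S : set nat := fun i => sgp mu H i.
Let f := (H * mu - 1)%N.
Notation C := (curve_of S).

Let Ef : f.*2 = (2 * H * mu - 2)%N. Proof. by rewrite /f -addnn; nia. Qed.
Let hS : semigroup_set S.
Proof. by split=> [|i j]; [rewrite /S /sgp mod0n | exact: sgpD]. Qed.
Let S_ge i : (f.*2.+1 <= i)%N -> S i.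
Proof. by rewrite Ef => ?; apply: sgp_gt. Qed.
Let S_half : ~ S f. Proof. exact/negP/sgp_half. Qed.
Let S_sym i : (i <= f.*2)%N -> i <> f -> S (f.*2 - i)%N <-> ~ S i.
Proof. by rewrite Ef /S => le_i ne_i; rewrite sgp_sym //; split=> [/negP|/negP]. Qed.

Lemma Kunz_sgp : Kunz C.
Proof. exact: (Kunz_curve hS S_ge S_half). Qed.

Lemma contributes_bound (F : sheaf C) : contributes F -> (h0 F + h1 F <= H * mu + 3 - mu)%N.
Proof.
case=> tfF h0F h1F; have [|V [j [V0 VD le0 le1]]] := sheaf_bound hS S_ge tfF; first exact: ltnW.
apply: leq_trans (leq_add le0 le1) _; apply: semimodule_bound => //.
  exact: leq_trans le0.
exact: leq_trans le1.
Qed.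

Lemma Cliff_sgp_trivial : (H * mu + 3 - mu < 4)%N -> Cliff C = 0.
Proof.
move=> lt4; apply: xgetPN => x [[F [contF _]] _].
have := contributes_bound contF; case: contF => _ h0F h1F.
by have := leq_add h0F h1F; lia.
Qed.

Lemma Cliff_sgp : (1 < H)%N -> Cliff C = (mu - 2)%N.
Proof.
move=> H_gt1.
have le_mu : (mu <= H * mu)%N by rewrite leq_pmull.
have elems : count (fun n => `[<S n>]) (iota 0 mu.+1) = 2%N.
  have -> : mu.+1 = (1 + (mu - 1) + 1)%N by lia.
  rewrite !iotaD !count_cat /= !add0n subnKC; last by lia.
  have -> : `[<S 0>] = true by apply/asboolP; case: hS.
  have -> : `[<S mu>] = true.
    by apply/asboolP; rewrite /S -[mu in sgp _ _ mu]mul1n -[X in sgp _ _ X]addn0 sgpE //; lia.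
  suff -> : count (fun n => `[<S n>]) (iota 1 (mu - 1)) = 0%N by [].
  apply/eqP; rewrite -leqn0 leqNgt -has_count; apply/hasPn => i.
  rewrite mem_iota => /andP[i0 lt_i]; apply/asboolPn.
  rewrite /S -[i]add0n -(mul0n mu) sgpE; last by lia.
  by rewrite /sgp_height; do 2?[case: eqP => ?]; lia.
have h0L : h0 (line_bundle (S := S) mu) = 2%N by rewrite (h0_line_bundle hS S_ge).
have gaps : count (fun n => ~~ `[<S n>]) (iota 0 mu.+1) = (mu - 1)%N.
  apply/eqP; rewrite -(eqn_add2l 2) -{1}elems; apply/eqP.
  by apply: etrans (count_predC _ _) _; rewrite size_iota; lia.
have h1L : (h1 (line_bundle (S := S) mu) = H * mu + 1 - mu)%N.
  have := h1_line_bundle_gaps hS S_ge S_half erefl S_sym mu; rewrite gaps /f; lia.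
pose CE := Cliff_sheafE hS S_ge S_half erefl S_sym.
have lower (F : sheaf C) : contributes F -> ((mu - 2)%N : int) <= Cliff_sheaf F.
  by move/contributes_bound => le_h; rewrite CE /f; lia.
have contL : contributes (C := C) (line_bundle mu).
  by split; [exact: line_bundle_tf | rewrite h0L | rewrite h1L; nia].
have CL : Cliff_sheaf (C := C) (line_bundle mu) = (mu - 2)%N.
  by rewrite CE h0L h1L /f; nia.
apply: xget_unique => [|y [[F [contF <-]] min_y]].
  by split=> //; exists (line_bundle mu).
by apply/eqP; rewrite eq_le lower // -CL min_y.
Qed.

End Clifford.

End LocalRings.

Lemma sgp_numerical mu H : (2 < mu)%N -> (0 < H)%N ->
  numerical_semigroup (fun i => sgp mu H i) /\ ~ sgp mu H 1%N.
Proof.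
move=> mu_ge3 H_gt0; split; first split.
- by rewrite /sgp mod0n.
- by move=> a b; apply: sgpD.
- apply: (@sub_finite_set _ _ `I_(2 * H * mu - 1)); last exact: finite_II.
  move=> i /= nSi; rewrite ltnNge; apply/negP => le_i.
  by apply: nSi; apply: sgp_gt => //; nia.
rewrite -[1%N]add0n -(mul0n mu) sgpE; last by lia.
by rewrite /sgp_height; do 2?[case: eqP => ?]; lia.
Qed.

Lemma monomial_curveE (k : closedFieldType) (S : set nat) :
  monomial_curve k S = curve_of (@FracField.tofrac {poly k} : {rmorphism _ -> _}) S.
Proof. by []. Qed.

Theorem mainTheorem3 (k : closedFieldType) (n : nat) :
  exists C : curve k, monomial_unicuspidal C /\ Kunz C /\ Cliff C = Posz n.
Proof.
have [[mu H] [/= mu_ge3 H_gt0 mu_leH CliffE]] : exists p : nat * nat,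
    [/\ (2 < p.1)%N, (0 < p.2)%N, (p.1 <= 2 * p.2 + 1)%N &
        Cliff (monomial_curve k (fun i => sgp p.1 p.2 i)) = n].
  have inj : injective (@FracField.tofrac {poly k}).
    by move=> p q /eqP; rewrite tofrac_eq => /eqP.
  case: n => [|n].
    exists (3, 1)%N; split=> //; rewrite monomial_curveE.
    by apply: Cliff_sgp_trivial => //; exact: fracP.
  exists (n.+3, n.+3); split=> //=; first by lia.
  rewrite monomial_curveE Cliff_sgp //; [exact: fracP | lia].
exists (monomial_curve k (fun i => sgp mu H i)); split; last split=> //.
  by have [nS nS1] := sgp_numerical mu_ge3 H_gt0; exists (fun i => sgp mu H i).
rewrite monomial_curveE; apply: Kunz_sgp => //; last exact: fracP.
by move=> p q /eqP; rewrite tofrac_eq => /eqP.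
Qed.
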